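(* Let $d$ be a metric on $\partial\mathbf{H}^n_{\mathbb K}=\mathfrak H_{\mathbb K}\cup\{\infty\}$ which induces the same topology on $\partial\mathbf{H}^n_{\mathbb K}$ as the Korányi metric $d_{\mathfrak H}$ and has the same remote point $\infty$ as $d_{\mathfrak H}$. Assume further that $\mathcal M_d=\mathcal M_{d_{\mathfrak H}}$. Then there exist $\alpha\in(0,1]$ and $\beta>0$ such that $d=\beta\cdot d_{\mathfrak H}^{\alpha}$.
   Context: $\mathbb K$ is one of $\mathbb R,\mathbb C,\mathbb H,\mathbb O$ (reals, complex numbers, quaternions, octonions), with conjugation $z\mapsto\overline z$ (the identity if $\mathbb K=\mathbb R$) and norm $|z|$; $n\ge 2$ is an integer, and $n=2$ if $\mathbb K=\mathbb O$. Put $\Im(\mathbb K)=\{z\in\mathbb K: z=-\overline z\}$, $\operatorname{Im}z=(z-\overline z)/2$, and $\|\zeta\|^2=\sum_i|\zeta_i|^2$ for $\zeta\in\mathbb K^{n-1}$. The $\mathbb K$-Heisenberg group $\mathfrak H_{\mathbb K}$ is the set $\mathbb K^{n-1}\times\Im(\mathbb K)$ with the multiplication $(\zeta,v)*(\zeta',v')=(\zeta+\zeta',\,v+v'+2\omega(\zeta,\zeta'))$, where $\omega(\zeta,\zeta')=\operatorname{Im}\big(\sum_i\overline{\zeta'_i}\zeta_i\big)$; thus $(\zeta,v)^{-1}=(-\zeta,-v)$, and the origin is $o=(0,0)$. The boundary of $\mathbb K$-hyperbolic space $\mathbf H^n_{\mathbb K}$ is identified with $\partial\mathbf{H}^n_{\mathbb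 K}=\mathfrak H_{\mathbb K}\cup\{\infty\}$. The Korányi gauge is $|(\zeta,v)|_{\mathbb K}=(\|\zeta\|^4+|v|^2)^{1/4}$ and the Korányi metric is $d_{\mathfrak H}(p,q)=|q^{-1}*p|_{\mathbb K}$ on $\mathfrak H_{\mathbb K}$. A metric on $\partial\mathbf{H}^n_{\mathbb K}$ with remote point $\infty$ means a metric $d$ on $S=\mathfrak H_{\mathbb K}$ extended to $\overline S=S\cup\{\infty\}$ by $d(p,\infty)=+\infty$ for $p\in S$ and $d(\infty,\infty)=0$. The $d$-topology on $\overline S$ is the one extending the metric topology of $S$ for which the sets $\{q\in S:d(o,q)>R\}\cup\{\infty\}$, $R>0$, are basic neighbourhoods of $\infty$. For pairwise distinct $p_1,\dots,p_4\in\overline S$ the metric cross-ratio is $|\mathbb X^d|(p_1,p_2,p_3,p_4)=\frac{d(p_4,p_2)}{d(p_4,p_1)}\cdot\frac{d(p_3,p_1)}{d(p_3,p_2)}$, where, if one of the points is $\infty$, the two factors containing $\infty$ are cancelled. The Möbius group $\mathcal M_d$ is the group of homeomorphisms of $\overline S$ (in the $d$-topology) which leave $|\mathbb X^d|$ invariant on all quadruples of pairwise distinct points of $\overline S$. *)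

(* Defs.v *)
From HB Require Import structures.
From mathcomp Require Import all_boot all_order all_algebra.
From mathcomp Require Import all_classical all_reals all_analysis.

Set Implicit Arguments.
Unset Strict Implicit.
Unset Printing Implicit Defensive.

Import Order.TTheory GRing.Theory Num.Theory.

Local Open Scope classical_set_scope.
Local Open Scope ring_scope.

(* The algebras R, C, H, O are the first four algebras of the Cayley-Dickson
   tower over R.  Multiplication on cd R m is not associative for m >= 3, so it
   is a plain function and not part of a ring structure. *)
Fixpoint cd (R : realType) (m : nat) : lmodType R :=
  if m is m'.+1 then (cd R m' * cd R m')%type : lmodType R else R^o.

Fixpoint cd_conj (R : realType) (m : nat) : cd R m -> cd R m :=
  match m with
  | 0 => fun z => z
  | m'.+1 => fun z => (cd_conj z.1, - z.2)
  end.

Fixpoint cd_mul (R : realType) (m : nat) : cd R m -> cd R m -> cd R m :=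
  match m with
  | 0 => fun z w => (z : R) * w
  | m'.+1 => fun z w =>
      (cd_mul z.1 w.1 - cd_mul (cd_conj w.2) z.2,
       cd_mul w.2 z.1 + cd_mul z.2 (cd_conj w.1))
  end.

Fixpoint cd_norm (R : realType) (m : nat) : cd R m -> R :=
  match m with
  | 0 => fun z => `|z : R|
  | m'.+1 => fun z => Num.sqrt (cd_norm z.1 ^+ 2 + cd_norm z.2 ^+ 2)
  end.

Inductive division_algebra := Reals | Complexes | Quaternions | Octonions.

Definition doublings (K : division_algebra) : nat :=
  match K with
  | Reals => 0
  | Complexes => 1
  | Quaternions => 2
  | Octonions => 3
  end.

Definition scalars (R : realType) (K : division_algebra) : lmodType R :=
  cd R (doublings K).

Lemma cd_conjB (R : realType) m (z w : cd R m) :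
  cd_conj (z - w) = cd_conj z - cd_conj w.
Proof.
elim: m z w => [//|m IH] [z1 z2] [w1 w2] /=.
by congr pair; [exact: IH | exact: opprD].
Qed.

Lemma cd_conjK (R : realType) m (z : cd R m) : cd_conj (cd_conj z) = z.
Proof. by elim: m z => [//|m IH] [z1 z2] /=; rewrite IH opprK. Qed.

Lemma cd_conjZ (R : realType) m (a : R) (z : cd R m) :
  cd_conj (a *: z) = a *: cd_conj z.
Proof.
elim: m z => [//|m IH] [z1 z2] /=.
by congr pair; [exact: IH | rewrite -scalerN].
Qed.

Definition is_imag (R : realType) (m : nat) : {pred cd R m} :=
  fun z => z == - cd_conj z.

Lemma is_imag_zmod_closed (R : realType) m : zmod_closed (@is_imag R m).
Proof.
split=> [|z w]; rewrite !unfold_in /is_imag.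
  by rewrite -(subrr 0) cd_conjB !subrr oppr0.
move=> /eqP zE /eqP wE; apply/eqP.
by rewrite cd_conjB opprB {1}zE {1}wE opprK addrC.
Qed.

HB.instance Definition _ (R : realType) (m : nat) :=
  GRing.isZmodClosed.Build (cd R m) (@is_imag R m) (@is_imag_zmod_closed R m).

Record imag (R : realType) (m : nat) := Imag {
  imag_val :> cd R m;
  imag_valP : imag_val \in @is_imag R m
}.

HB.instance Definition _ (R : realType) (m : nat) :=
  [isSub for @imag_val R m].
HB.instance Definition _ (R : realType) (m : nat) :=
  [Choice of imag R m by <:].
HB.instance Definition _ (R : realType) (m : nat) :=
  [SubChoice_isSubZmodule of imag R m by <:].

Lemma imag_part_subproof (R : realType) m (z : cd R m) :
  2^-1 *: (z - cd_conj z) \in @is_imag R m.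
Proof.
by rewrite unfold_in /is_imag cd_conjZ cd_conjB cd_conjK -scalerN opprB.
Qed.

Definition imag_part (R : realType) (m : nat) (z : cd R m) : imag R m :=
  Imag (imag_part_subproof z).

Definition heis (R : realType) (K : division_algebra) (n : nat) : Type :=
  ('rV[scalars R K]_n.-1 * imag R (doublings K))%type.

HB.instance Definition _ (R : realType) K n :=
  GRing.Zmodule.copy (heis R K n)
    ('rV[scalars R K]_n.-1 * imag R (doublings K))%type.

Section Heisenberg.
Context {R : realType} {K : division_algebra} {n : nat}.

Definition omega (zeta zeta' : 'rV[scalars R K]_n.-1) : imag R (doublings K) :=
  imag_part (\sum_i cd_mul (cd_conj (zeta' 0 i)) (zeta 0 i)).

Definition heis_mul (p q : heis R K n) : heis R K n :=
  (p.1 + q.1, p.2 + q.2 + omega p.1 q.1 *+ 2).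

Definition heis_inv (p : heis R K n) : heis R K n := (- p.1, - p.2).

Definition heis_o : heis R K n := (0, 0).

Definition row_norm (zeta : 'rV[scalars R K]_n.-1) : R :=
  Num.sqrt (\sum_i cd_norm (zeta 0 i) ^+ 2).

Definition koranyi_gauge (p : heis R K n) : R :=
  (row_norm p.1 ^+ 4 + cd_norm (p.2 : cd R _) ^+ 2) `^ 4^-1.

Definition koranyi_dist (p q : heis R K n) : R :=
  koranyi_gauge (heis_mul (heis_inv q) p).

End Heisenberg.

Definition is_metric (R : realType) (S : Type) (d : S -> S -> R) : Prop :=
  [/\ forall x y, 0 <= d x y,
      forall x y, d x y = 0 <-> x = y,
      forall x y, d x y = d y x &
      forall x y z, d x z <= d x y + d y z].

(* The one-point extension of S is [option S], with [None] as the remote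
   point. *)
Definition ext_dist (R : realType) (S : Type) (d : S -> S -> R)
    (p q : option S) : \bar R :=
  match p, q with
  | Some x, Some y => (d x y)%:E
  | None, None => 0%E
  | _, _ => +oo%E
  end.

(* [option S] with the topology given by [d], [o] being the base point used for
   the neighbourhoods of infinity. *)
Definition ext_space (R : realType) (S : choiceType) (o : S)
  (d : S -> S -> R) : Type := option S.

HB.instance Definition _ (R : realType) (S : choiceType) (o : S)
  (d : S -> S -> R) := Choice.copy (ext_space o d) (option S).

Section ExtTopology.
Context {R : realType} {S : choiceType} (o : S) (d : S -> S -> R).

Definition ext_open (U : set (ext_space o d)) : Prop :=
  (forall x, U (Some x) ->
     exists2 e : R, 0 < e & forall y, d x y < e -> U (Some y)) /\
  (U None -> exists2 r : R, 0 < r & forall y, d o y > r -> U (Some y)).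

Lemma ext_openT : ext_open setT.
Proof. by split=> [x|] _; exists 1. Qed.

Lemma ext_openI : setI_closed ext_open.
Proof.
move=> U V [US UN] [VS VN]; split=> [x|] [].
  move=> /US[e e0 eU] /VS[e' e'0 eV]; exists (Num.min e e').
    by rewrite lt_min e0.
  by move=> y; rewrite lt_min => /andP[/eU ? /eV ?].
move=> /UN[e e0 eU] /VN[e' e'0 eV]; exists (Num.max e e').
  by rewrite lt_max e0.
by move=> y; rewrite gt_max => /andP[/eU ? /eV ?].
Qed.

Lemma ext_open_bigU (I : Type) (f : I -> set (ext_space o d)) :
  (forall i, ext_open (f i)) -> ext_open (\bigcup_i f i).
Proof.
move=> fo; split=> [x|] [i _].
  by move=> /((fo i).1 x)[e e0 ef]; exists e => // y /ef; exists i.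
by move=> /(fo i).2[e e0 ef]; exists e => // y /ef; exists i.
Qed.

HB.instance Definition _ :=
  isOpenTopological.Build (ext_space o d) ext_openT ext_openI ext_open_bigU.

Definition ext_topology : set (set (option S)) :=
  [set U | open (U : set (ext_space o d))].

End ExtTopology.

(* Cancelling the factors that contain infinity amounts to replacing them
   by 1. *)
Definition cr_factor (R : realType) (S : Type) (d : S -> S -> R)
    (p q : option S) : R :=
  match p, q with
  | Some x, Some y => d x y
  | _, _ => 1
  end.

Definition cross_ratio (R : realType) (S : Type) (d : S -> S -> R)
    (p1 p2 p3 p4 : option S) : R :=
  cr_factor d p4 p2 / cr_factor d p4 p1 *
  (cr_factor d p3 p1 / cr_factor d p3 p2).

Definition homeomorphism (T U : topologicalType) (f : T -> U) : Prop :=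
  exists g : U -> T, [/\ cancel f g, cancel g f, continuous f & continuous g].

Definition mobius (R : realType) (S : choiceType) (o : S) (d : S -> S -> R) :
    set (option S -> option S) :=
  [set f | homeomorphism (f : ext_space o d -> ext_space o d) /\
     forall p1 p2 p3 p4 : option S, uniq [:: p1; p2; p3; p4] ->
       cross_ratio d (f p1) (f p2) (f p3) (f p4) =
       cross_ratio d p1 p2 p3 p4].

(* Main.v *)
Require Import Defs.
From mathcomp Require Import all_boot all_order all_algebra.
From mathcomp Require Import all_classical all_reals all_analysis.
From mathcomp Require Import ring lra.

Set Implicit Arguments.
Unset Strict Implicit.
Unset Printing Implicit Defensive.

Import Order.TTheory GRing.Theory Num.Theory.

Local Open Scope classical_set_scope.
Local Open Scope ring_scope.

(** Write k for the Koranyi distance and |p| for its gauge.  A Mobius map fixing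
infinity is a similarity of d, because the metric cross-ratio with one point at
infinity is a quotient of two distances ([mobius_similarity]).  Left
translations, the dilations [dil], the Koranyi inversion [koranyi_inv] and some
rotations about the origin are Mobius for k, hence for d, and they determine d.

- Translations are isometries of d ([translation_isometry]).  Conjugation by the
  dilation D of ratio 2 turns the translation by g into the translation by D g
  without changing its d-ratio c.  Since D g = g g if g = (zeta, 0) and
  D g = g g g g if g = (0, v), this gives c = c^2 or c = c^4, so c = 1.  Hence d
  is determined by rho x = d o x.
- Dilations multiply rho by a ratio which is multiplicative in r and smaller
  than 1 for r < 1, because points close to o for k are close to o for d.  Such
  a ratio is r^alpha ([multiplicative_powR]).
- The inversion exchanges o and infinity, so the cross-ratio of o, infinity, x
  and y shows that rho x * rho (I x) is a constant c.  If |p| = 1, some rotation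
  takes I p to the inverse of p ([koranyi_inv_rotation]); rotations preserve rho
  because rho is bounded on the unit sphere, and rho is the same at p and at its
  inverse.  Hence rho p ^ 2 = c: rho is constant on the unit sphere
  ([rho_unit_sphere]), even where the rotations do not act transitively on it.

So d = beta k^alpha, and the triangle inequality for o, p and p p with
p = (zeta, 0) gives 2^alpha <= 2.

The geometry of k rests on one formula.  With a(p) = |zeta|^2 + v for
p = (zeta, v), the fourth power of k(p, q) is the squared norm of
a(p) + conj a(q) - 2 sum_i conj(zeta_i) zeta'_i ([koranyi_dist_pow4]).  That
inversions and rotations respect it is a computation with the scalar product of
the algebra K, where the adjoint of a multiplication is the multiplication by
the conjugate and conj x (x y) = |x|^2 y.  Associativity is used for R, C and
H; for O it is replaced by a Moufang identity, and zeta has one coordinate. *)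

(** * Cayley-Dickson algebras as composition algebras *)

Section CayleyDickson.
Variable R : realType.
Implicit Types m : nat.

Fixpoint ip {m} : cd R m -> cd R m -> R :=
  match m with
  | 0 => fun z w => (z : R) * w
  | m'.+1 => fun z w => ip z.1 w.1 + ip z.2 w.2
  end.

Fixpoint cd1 {m} : cd R m :=
  match m with 0 => (1 : R) | m'.+1 => (cd1, 0) end.

Lemma ipC m (x y : cd R m) : ip x y = ip y x.
Proof.
elim: m x y => [|m IH] x y /=; first exact: mulrC.
by rewrite (IH x.1) (IH x.2).
Qed.

Lemma ipDl m (x y z : cd R m) : ip (x + y) z = ip x z + ip y z.
Proof.
elim: m x y z => [|m IH] x y z /=; first exact: mulrDl.
by rewrite !IH addrACA.
Qed.

Lemma ipZl m (a : R) (x z : cd R m) : ip (a *: x) z = a * ip x z.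
Proof.
elim: m x z => [|m IH] x z /=; first by rewrite -mulrA.
by rewrite !IH mulrDr.
Qed.

Lemma ipDr m (x y z : cd R m) : ip z (x + y) = ip z x + ip z y.
Proof. by rewrite ipC ipDl !(ipC z). Qed.

Lemma ipZr m (a : R) (x z : cd R m) : ip z (a *: x) = a * ip z x.
Proof. by rewrite ipC ipZl (ipC z). Qed.

Lemma ipNl m (x z : cd R m) : ip (- x) z = - ip x z.
Proof. by rewrite -scaleN1r ipZl mulN1r. Qed.

Lemma ipNr m (x z : cd R m) : ip z (- x) = - ip z x.
Proof. by rewrite ipC ipNl ipC. Qed.

Lemma ip0l m (z : cd R m) : ip 0 z = 0.
Proof. by rewrite -(scale0r (0 : cd R m)) ipZl mul0r. Qed.

Lemma ip0r m (z : cd R m) : ip z 0 = 0.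
Proof. by rewrite ipC ip0l. Qed.

Lemma ip_ge0 m (x : cd R m) : 0 <= ip x x.
Proof.
elim: m x => [|m IH] x /=; first by rewrite -expr2 sqr_ge0.
exact: addr_ge0.
Qed.

Lemma ip_eq0 m (x : cd R m) : (ip x x == 0) = (x == 0).
Proof.
apply/eqP/eqP => [|->]; last exact: ip0l.
elim: m x => [|m IH] x /=.
  by move/eqP; rewrite -expr2 sqrf_eq0 => /eqP.
move/eqP; rewrite paddr_eq0 ?ip_ge0// => /andP[/eqP/IH x1 /eqP/IH x2].
by rewrite (surjective_pairing x) x1 x2.
Qed.

Lemma cd_norm_sqr m (x : cd R m) : cd_norm x ^+ 2 = ip x x.
Proof.
elim: m x => [|m IH] x /=; first by rewrite real_normK ?num_real// expr2.
by rewrite sqr_sqrtr ?addr_ge0 ?sqr_ge0// !IH.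
Qed.

Lemma cd_conjD m (x y : cd R m) : cd_conj (x + y) = cd_conj x + cd_conj y.
Proof. 
elim: m x y => [//|m IH] x y /=.
by rewrite IH opprD.
Qed.

Lemma cd_conjN m (x : cd R m) : cd_conj (- x) = - cd_conj x.
Proof. by rewrite -scaleN1r cd_conjZ scaleN1r. Qed.

Lemma cd_conj0 m : cd_conj (0 : cd R m) = 0.
Proof. by rewrite -[in LHS](scale0r (0 : cd R m)) cd_conjZ scale0r. Qed.

Lemma cd_conj1 m : cd_conj (@cd1 m) = cd1.
Proof. by elim: m => [//|m IH] /=; rewrite IH oppr0. Qed.

Lemma ip_conj m (x y : cd R m) : ip (cd_conj x) y = ip x (cd_conj y).
Proof.
elim: m x y => [//|m IH] x y /=.
by rewrite IH ipNl ipNr.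
Qed.

Lemma ip_conj2 m (x y : cd R m) : ip (cd_conj x) (cd_conj y) = ip x y.
Proof. by rewrite ip_conj cd_conjK. Qed.

Lemma cd_mul_bilinear m :
  (forall a (x y z : cd R m),
     cd_mul (a *: x + y) z = a *: cd_mul x z + cd_mul y z) /\
  (forall a (x y z : cd R m),
     cd_mul z (a *: x + y) = a *: cd_mul z x + cd_mul z y).
Proof.
elim: m => [|m [IHl IHr]]; split => a.
- by move=> x y z;
  exact: etrans (mulrDl (a * x) y z) (congr1 (+%R^~ _) (esym (mulrA a x z))).
- by move=> x y z; exact: etrans (mulrDr z (a * x) y) (congr1 (+%R^~ _) (mulrCA z a x)).
- move=> [x1 x2] [y1 y2] [z1 z2] /=; congr pair => /=.
    by rewrite IHl IHr opprD addrACA scalerBr.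
  by rewrite IHl IHr addrACA scalerDr.
- move=> [x1 x2] [y1 y2] [z1 z2] /=; congr pair => /=.
    by rewrite cd_conjD cd_conjZ IHl IHr opprD addrACA scalerBr.
  by rewrite cd_conjD cd_conjZ IHl IHr addrACA scalerDr.
Qed.

Lemma cd_mulDl m (x y z : cd R m) : cd_mul (x + y) z = cd_mul x z + cd_mul y z.
Proof. by rewrite -[x in LHS]scale1r (cd_mul_bilinear m).1 scale1r. Qed.

Lemma cd_mulDr m (x y z : cd R m) : cd_mul z (x + y) = cd_mul z x + cd_mul z y.
Proof. by rewrite -[x in LHS]scale1r (cd_mul_bilinear m).2 scale1r. Qed.

Lemma cd_mul0x m (z : cd R m) : cd_mul 0 z = 0.
Proof. by apply: (addrI (cd_mul 0 z)); rewrite -cd_mulDl !addr0. Qed.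

Lemma cd_mulx0 m (z : cd R m) : cd_mul z 0 = 0.
Proof. by apply: (addrI (cd_mul z 0)); rewrite -cd_mulDr !addr0. Qed.

Lemma cd_mulZl m a (x z : cd R m) : cd_mul (a *: x) z = a *: cd_mul x z.
Proof. by rewrite -[a *: x]addr0 (cd_mul_bilinear m).1 cd_mul0x addr0. Qed.

Lemma cd_mulZr m a (x z : cd R m) : cd_mul z (a *: x) = a *: cd_mul z x.
Proof. by rewrite -[a *: x]addr0 (cd_mul_bilinear m).2 cd_mulx0 addr0. Qed.

Lemma cd_mulNl m (x z : cd R m) : cd_mul (- x) z = - cd_mul x z.
Proof. by rewrite -scaleN1r cd_mulZl scaleN1r. Qed.

Lemma cd_mulNr m (x z : cd R m) : cd_mul z (- x) = - cd_mul z x.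
Proof. by rewrite -scaleN1r cd_mulZr scaleN1r. Qed.

Lemma cd_mul1_both m (x : cd R m) : cd_mul cd1 x = x /\ cd_mul x cd1 = x.
Proof.
elim: m x => [|m IH] x /=; first by rewrite mul1r mulr1.
rewrite cd_conj0 cd_conj1 !cd_mul0x cd_mulx0 !subr0 addr0 add0r.
by case: (IH x.1) (IH x.2) => [-> ->] [_ ->]; rewrite -surjective_pairing.
Qed.

Lemma cd_mul1x m (x : cd R m) : cd_mul cd1 x = x.
Proof. exact: (cd_mul1_both x).1. Qed.

Lemma cd_mulx1 m (x : cd R m) : cd_mul x cd1 = x.
Proof. exact: (cd_mul1_both x).2. Qed.

Lemma cd_conjM m (x y : cd R m) :
  cd_conj (cd_mul x y) = cd_mul (cd_conj y) (cd_conj x).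
Proof.
elim: m x y => [|m IH] x y /=; first exact: mulrC.
rewrite cd_conjB !IH !cd_conjK cd_conjN !cd_mulNl !cd_mulNr !opprK opprD.
by rewrite [- cd_mul y.2 _ - _]addrC.
Qed.

(** Both halves are proved together since the doubling formula mixes left and
right multiplications of the smaller algebra. *)
Lemma ip_mul_adjoint m (x y z : cd R m) :
  ip (cd_mul x y) z = ip y (cd_mul (cd_conj x) z) /\
  ip (cd_mul x y) z = ip x (cd_mul z (cd_conj y)).
Proof.
elim: m x y z => [|m IH] x y z /=; first by split; ring.
have IHl a b c := (IH a b c).1.
have IHr a b c := (IH a b c).2.
rewrite !ipDl !ipNl; split.
  rewrite !ipDr !ipNr !cd_mulNl !cd_mulNr !ipNr !opprK.
  rewrite (IHl x.1 y.1) (IHr y.2 x.1) (IHl (cd_conj y.2)) cd_conjK.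
  rewrite (IHl x.2) ip_conj cd_conjM cd_conjK.
  by rewrite (ipC y.2 (cd_mul x.2 _)) IHr cd_conjK; ring.
rewrite !ipDr cd_conjN !cd_mulNl opprK cd_conjK ipNr.
rewrite (IHr x.1 y.1) (IHl y.2 x.1) (IHr x.2) cd_conjK.
by rewrite (IHl (cd_conj y.2)) cd_conjK; ring.
Qed.

Lemma ip_mull m (x y z : cd R m) : ip (cd_mul x y) z = ip y (cd_mul (cd_conj x) z).
Proof. exact: (ip_mul_adjoint x y z).1. Qed.

Lemma ip_mulr m (x y z : cd R m) : ip (cd_mul x y) z = ip x (cd_mul z (cd_conj y)).
Proof. exact: (ip_mul_adjoint x y z).2. Qed.

Lemma cd_mul_conjl m (x : cd R m) : cd_mul (cd_conj x) x = ip x x *: cd1.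
Proof.
elim: m x => [|m IH] x /=; first by rewrite -[RHS]/(x * x * 1) mulr1.
rewrite cd_mulNr cd_mulNl opprK !IH subrr.
by congr pair; rewrite /= ?scaler0 ?scalerDl ?scaler0 /= ?addr0.
Qed.

Lemma cd_mul_conjr m (x : cd R m) : cd_mul x (cd_conj x) = ip x x *: cd1.
Proof. by rewrite -[x in cd_mul x]cd_conjK cd_mul_conjl ip_conj2. Qed.

Lemma cd_trace m (x : cd R m) : x + cd_conj x = (2 * ip x cd1) *: cd1.
Proof.
elim: m x => [|m IH] x /=.
  by rewrite -[RHS]/(2 * (x * 1) * 1); ring.
by congr pair; rewrite /= ?subrr ?scaler0 // ip0r addr0.
Qed.

Lemma cd_mulC m (x y : cd R m) : (m <= 1)%N -> cd_mul x y = cd_mul y x.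
Proof.
case: m x y => [|[|//]] x y _ /=; first exact: mulrC.
by congr pair; rewrite [LHS]addrC [RHS]addrC /=; ring.
Qed.

(** Doubling a commutative associative algebra keeps associativity, and doubling
an algebra with trivial conjugation keeps commutativity; this reaches the
quaternions. *)
Lemma cd_mulA m (x y z : cd R m) : (m <= 2)%N ->
  cd_mul x (cd_mul y z) = cd_mul (cd_mul x y) z.
Proof.
elim: m x y z => [|m IH] x y z m2 /=; first exact: mulrA.
have {}IH a b c := IH a b c (ltnW m2).
have C a b : cd_mul a b = cd_mul b a :> cd R m by apply: cd_mulC.
have cyc a b c : cd_mul (cd_mul a b) c = cd_mul (cd_mul b c) a :> cd R m.
  by rewrite -IH C.
have swap a b c : cd_mul (cd_mul a b) c = cd_mul (cd_mul a c) b :> cd R m.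
  by rewrite -!IH (C b).
pose E := (@cd_conjD, @cd_conjN, @cd_conjM, @cd_conjK, @cd_mulDl, @cd_mulDr,
           @cd_mulNl, @cd_mulNr, IH, @opprD).
congr pair; rewrite /= !E /=.
  rewrite (cyc x.1 _ y.2) (cyc _ _ x.2) (cyc z.1).
  by rewrite -!addrA; congr (_ + _); rewrite addrA addrC addrA.
rewrite (swap z.2 y.1) (swap y.2) (swap x.2 (cd_conj z.1)).
rewrite (cyc x.2 (cd_conj y.2)) (C (cd_conj y.2)).
by rewrite -!addrA; congr (_ + _); rewrite [RHS]addrC -!addrA.
Qed.

(** In a double of an associative algebra the two mixed terms of each component
cancel; this reaches the octonions, and makes the norm multiplicative. *)
Lemma cd_alternative m (x y : cd R m) : (m <= 3)%N ->
  cd_mul (cd_conj x) (cd_mul x y) = ip x x *: y.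
Proof.
case: m x y => [|m] x y m3 /=; first exact: mulrA.
have A a b c : cd_mul a (cd_mul b c) = cd_mul (cd_mul a b) c :> cd R m.
  exact: cd_mulA.
pose E := (@cd_conjD, @cd_conjN, @cd_conjM, @cd_conjK, @cd_mulDl, @cd_mulDr,
           @cd_mulNl, @cd_mulNr, A, @opprD, @opprK).
congr pair; rewrite /= !E /=.
  by rewrite addrA subrK cd_mul_conjl -A cd_mul_conjl cd_mulZl cd_mulZr
    cd_mul1x cd_mulx1 scalerDl.
by rewrite addrA addrK -A !cd_mul_conjr cd_mulZl cd_mulZr cd_mul1x cd_mulx1
  scalerDl.
Qed.

Section Composition.
Variables (m : nat) (m3 : (m <= 3)%N).
Implicit Types x y z : cd R m.

Lemma cd_mulKVl x y : cd_mul x (cd_mul (cd_conj x) y) = ip x x *: y.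
Proof. by rewrite -[x in cd_mul x]cd_conjK cd_alternative// ip_conj2. Qed.

Lemma cd_mulKVr x y : cd_mul (cd_mul y x) (cd_conj x) = ip x x *: y.
Proof.
by apply: (can_inj (@cd_conjK R m)); rewrite !cd_conjM cd_conjK cd_mulKVl cd_conjZ.
Qed.

Lemma cd_mulKr x y : cd_mul (cd_mul y (cd_conj x)) x = ip x x *: y.
Proof. by rewrite -[x in LHS]cd_conjK cd_conjK cd_mulKVr ip_conj2. Qed.

Lemma ip_mul2l x y z : ip (cd_mul x y) (cd_mul x z) = ip x x * ip y z.
Proof. by rewrite ip_mull cd_alternative// ipZr. Qed.

Lemma ip_mul2r x y z : ip (cd_mul y x) (cd_mul z x) = ip x x * ip y z.
Proof. by rewrite ip_mulr cd_mulKVr ipZr. Qed.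

Lemma ip_mulM x y : ip (cd_mul x y) (cd_mul x y) = ip x x * ip y y.
Proof. exact: ip_mul2l. Qed.

End Composition.

End CayleyDickson.

Arguments cd1 {R m}.
Arguments ip {R m}.

(** Pairing with an arbitrary vector turns a linear identity in the algebra, which
is not a ring, into an identity over R that can be decided by normalization. *)
Lemma ip_ext (R : realType) m (x y : cd R m) : (forall w, ip x w = ip y w) -> x = y.
Proof.
move=> xy; apply/eqP; rewrite -subr_eq0 -ip_eq0 ipDl ipNl.
by rewrite xy subrr.
Qed.

Ltac cd_linear :=
  apply: ip_ext => ?; rewrite ?(ipDl, ipNl, ipZl, ip0l); ring.

Lemma ip_imag_one (R : realType) m (x : cd R m) : cd_conj x = - x -> ip x cd1 = 0.
Proof.
move=> xN; have : ip x cd1 = - ip x cd1.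
  by rewrite -{1}(cd_conj1 R m) -ip_conj xN ipNl.
lra.
Qed.

(** * Imaginary elements *)

Section Imaginary.
Variables (R : realType) (m : nat).
Implicit Types (v w : imag R m) (z : cd R m).

Lemma imag_valD v w : imag_val (v + w) = imag_val v + imag_val w.
Proof. exact: GRing.valD. Qed.

Lemma imag_valN v : imag_val (- v) = - imag_val v.
Proof. exact: GRing.valN. Qed.

Lemma imag_val0 : imag_val (0 : imag R m) = 0.
Proof. by rewrite -(subrr (0 : imag R m)) imag_valD imag_valN subrr. Qed.

Lemma imag_conj v : cd_conj v = - (v : cd R m).
Proof.
by have /eqP vE := imag_valP v; rewrite [in RHS]vE opprK.
Qed.

Lemma imag_partE z : imag_val (imag_part z) = 2^-1 *: (z - cd_conj z).
Proof. by []. Qed.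

Lemma imag_partK z : cd_conj z = - z -> imag_val (imag_part z) = z.
Proof.
move=> zE; rewrite imag_partE zE opprK scalerDr -scalerDl.
by have -> : 2^-1 + 2^-1 = 1 :> R; [field | rewrite scale1r].
Qed.

Lemma imag_part2 z : imag_val (imag_part z *+ 2) = z - cd_conj z.
Proof.
rewrite mulr2n imag_valD imag_partE -scalerDl.
by have -> : 2^-1 + 2^-1 = 1 :> R; [field | rewrite scale1r].
Qed.

Lemma ip_imag1 v : ip (v : cd R m) cd1 = 0.
Proof. exact: ip_imag_one (imag_conj v). Qed.

End Imaginary.

Lemma ip_cd1 (R : realType) m : ip (@cd1 R m) cd1 = 1.
Proof. by elim: m => [|m IH] /=; rewrite ?mulr1// IH ip0l addr0. Qed.

(** * The Heisenberg group and its gauge *)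

Section Heisenberg.
Variables (R : realType) (K : division_algebra) (n : nat).
Notation A := (scalars R K).
Notation V := 'rV[scalars R K]_n.-1.
Notation H := (heis R K n).
Implicit Types (z w : V) (p q g : H) (r : R).

Definition herm z w : A := \sum_i cd_mul (cd_conj (z 0 i)) (w 0 i).

Definition row_ip z w : R := \sum_i ip (z 0 i) (w 0 i).

Lemma row_norm_sqr z : row_norm z ^+ 2 = row_ip z z.
Proof.
rewrite sqr_sqrtr ?sumr_ge0// => [|i _]; last exact: sqr_ge0.
by apply: eq_bigr => i _; rewrite cd_norm_sqr.
Qed.

Lemma row_ip_ge0 z : 0 <= row_ip z z.
Proof. by apply: sumr_ge0 => i _; apply: ip_ge0. Qed.

Lemma row_ip_eq0 z : row_ip z z = 0 -> z = 0.
Proof.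
move/eqP; rewrite psumr_eq0 => [|i _]; last exact: ip_ge0.
move/allP => z0; apply/rowP => i; rewrite mxE.
by have := z0 i (mem_index_enum _); rewrite ip_eq0 => /eqP.
Qed.

Lemma herm_conj z w : cd_conj (herm z w) = herm w z.
Proof.
rewrite (big_morph _ (@cd_conjD R _) (@cd_conj0 R _)).
by apply: eq_bigr => i _; rewrite cd_conjM cd_conjK.
Qed.

Lemma hermDr z w1 w2 : herm z (w1 + w2) = herm z w1 + herm z w2.
Proof. by rewrite -big_split; apply: eq_bigr => i _; rewrite mxE cd_mulDr. Qed.

Lemma hermNr z w : herm z (- w) = - herm z w.
Proof. by rewrite -sumrN; apply: eq_bigr => i _; rewrite mxE cd_mulNr. Qed.

Lemma hermDl z1 z2 w : herm (z1 + z2) w = herm z1 w + herm z2 w.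
Proof. by rewrite -herm_conj hermDr cd_conjD !herm_conj. Qed.

Lemma hermNl z w : herm (- z) w = - herm z w.
Proof. by rewrite -herm_conj hermNr cd_conjN !herm_conj. Qed.

Lemma herm0r z : herm z 0 = 0.
Proof. by rewrite -(subrr (0 : V)) hermDr hermNr subrr. Qed.

Lemma herm0l z : herm 0 z = 0.
Proof. by rewrite -herm_conj herm0r cd_conj0. Qed.

Lemma row_ip_herm z w : row_ip z w = ip (herm z w) cd1.
Proof.
rewrite (big_morph (fun x => ip x cd1) (fun x y => ipDl x y cd1) (ip0l cd1)).
by apply: eq_bigr => i _; rewrite ip_mull cd_conjK cd_mulx1 ipC.
Qed.

Lemma row_ipDl z1 z2 w : row_ip (z1 + z2) w = row_ip z1 w + row_ip z2 w.
Proof. by rewrite !row_ip_herm hermDl ipDl. Qed.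

Lemma row_ipC z w : row_ip z w = row_ip w z.
Proof. by apply: eq_bigr => i _; rewrite ipC. Qed.

Lemma row_ipNl z w : row_ip (- z) w = - row_ip z w.
Proof. by rewrite !row_ip_herm hermNl ipNl. Qed.

Lemma row_ipDr z1 z2 w : row_ip w (z1 + z2) = row_ip w z1 + row_ip w z2.
Proof. by rewrite row_ipC row_ipDl !(row_ipC w). Qed.

Lemma row_ipNr z w : row_ip w (- z) = - row_ip w z.
Proof. by rewrite row_ipC row_ipNl row_ipC. Qed.

Lemma row_ipB z w : row_ip (z - w) (z - w) = row_ip z z + row_ip w w - 2 * row_ip z w.
Proof.
rewrite !(row_ipDl, row_ipDr, row_ipNl, row_ipNr) (row_ipC w z); ring.
Qed.

Lemma omega_herm z w : imag_val (omega z w *+ 2) = herm w z - herm z w.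
Proof. by rewrite imag_part2 -/(herm w z) herm_conj. Qed.

Lemma heis_eq p q : p.1 = q.1 -> (p.2 : cd R _) = q.2 -> p = q.
Proof.
by case: p q => [p1 p2] [q1 q2] /= -> /val_inj ->.
Qed.

Lemma heis_mul1 p q : (heis_mul p q).1 = p.1 + q.1.
Proof. by []. Qed.

Lemma heis_mul2 p q : imag_val (heis_mul p q).2 =
  imag_val p.2 + imag_val q.2 + (herm q.1 p.1 - herm p.1 q.1).
Proof. by rewrite -omega_herm -imag_valD -imag_valD. Qed.

Lemma heis_inv1 p : (heis_inv p).1 = - p.1.
Proof. by []. Qed.

Lemma heis_inv2 p : imag_val (heis_inv p).2 = - imag_val p.2.
Proof. exact: imag_valN. Qed.

Lemma heis_o1 : (heis_o : H).1 = 0. Proof. by []. Qed.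

Lemma heis_o2 : imag_val (heis_o : H).2 = 0.
Proof. exact: imag_val0. Qed.

Definition heisE := (heis_mul1, heis_mul2, heis_inv1, heis_inv2, heis_o1, heis_o2).
Definition hermDE := (hermDl, hermDr, hermNl, hermNr, herm0l, herm0r).

Ltac heis_group :=
  apply: heis_eq; rewrite !heisE; [by rewrite ?opprD ?opprK ?oppr0 ?addr0 ?add0r ?addNr ?addrA
    | rewrite ?hermDE; cd_linear].

Lemma heis_mulA g p q : heis_mul g (heis_mul p q) = heis_mul (heis_mul g p) q.
Proof. heis_group. Qed.

Lemma heis_invK p : heis_inv (heis_inv p) = p.
Proof. heis_group. Qed.

Lemma heis_mulVp p : heis_mul (heis_inv p) p = heis_o.
Proof. heis_group. Qed.

Lemma heis_mulop p : heis_mul heis_o p = p.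
Proof. heis_group. Qed.

Lemma heis_mulpo p : heis_mul p heis_o = p.
Proof. heis_group. Qed.

Lemma heis_invM p q : heis_inv (heis_mul p q) = heis_mul (heis_inv q) (heis_inv p).
Proof.
apply: heis_eq; rewrite !heisE; first by rewrite opprD addrC.
by rewrite !hermDE; cd_linear.
Qed.

Lemma heis_mulK g : cancel (heis_mul g) (heis_mul (heis_inv g)).
Proof. by move=> p; rewrite heis_mulA heis_mulVp heis_mulop. Qed.

Lemma heis_mulVK g : cancel (heis_mul (heis_inv g)) (heis_mul g).
Proof. by move=> p; rewrite -{1}(heis_invK g) heis_mulK. Qed.

Lemma koranyi_translation g p q :
  koranyi_dist (heis_mul g p) (heis_mul g q) = koranyi_dist p q.
Proof.
rewrite /koranyi_dist; congr koranyi_gauge.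
by rewrite heis_invM heis_mulA -(heis_mulA _ _ g) heis_mulVp heis_mulpo.
Qed.

(** The Siegel coordinate |zeta|^2 + v of a point of the Heisenberg group, seen as
the boundary of the Siegel domain; its norm is the square of the gauge. *)
Definition siegel p : A := row_ip p.1 p.1 *: cd1 + (p.2 : cd R _).

Lemma gauge_ge0 p : 0 <= koranyi_gauge p.
Proof. exact: powR_ge0. Qed.

Lemma gauge_pow4 p : koranyi_gauge p ^+ 4 = ip (siegel p) (siegel p).
Proof.
rewrite -powR_mulrn ?powR_ge0// -powRrM mulVf// powRr1; last first.
  by rewrite addr_ge0 ?sqr_ge0// (exprM _ 2 2) sqr_ge0.
rewrite (exprM _ 2 2) row_norm_sqr cd_norm_sqr ipDl !ipDr !ipZl !ipZr.
by rewrite (ipC cd1) ip_imag1 ip_cd1; ring.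
Qed.

(** When K is associative this is, up to a factor, the Hermitian form of signature
(n, 1) evaluated on null vectors which represent the two points. *)
Definition siegel_form p q : A := siegel p + cd_conj (siegel q) - 2 *: herm p.1 q.1.

(** Expanding |zeta - zeta'|^2 produces twice the real part of the Hermitian
product and the group law twice its imaginary part; together they make up the
whole product. *)
Lemma koranyi_dist_pow4 p q : koranyi_dist p q ^+ 4 = ip (siegel_form p q) (siegel_form p q).
Proof.
rewrite gauge_pow4; suff -> : siegel (heis_mul (heis_inv q) p) = siegel_form p q by [].
rewrite /siegel_form /siegel heis_mul1 heis_inv1 (addrC (- _)) row_ipB.
rewrite heis_mul2 heis_inv1 heis_inv2 !hermDE cd_conjD cd_conjZ cd_conj1 imag_conj.
have := cd_trace (herm p.1 q.1); rewrite herm_conj -row_ip_herm => tr.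
apply: ip_ext => w; have := congr1 (ip^~ w) tr.
by rewrite !(ipDl, ipNl, ipZl) => {}tr; lra.
Qed.

Lemma pow4_inj x y : 0 <= x -> 0 <= y -> x ^+ 4 = y ^+ 4 -> x = y :> R.
Proof. by move=> x0 y0 /eqP; rewrite eqrXn2// => /eqP. Qed.

Lemma gauge0 : koranyi_gauge (heis_o : H) = 0.
Proof.
apply: pow4_inj; rewrite ?gauge_ge0// gauge_pow4 /siegel !heisE row_ip_herm herm0l ip0l.
by rewrite scale0r addr0 ip0l expr0n.
Qed.

Lemma siegel_eq0 p : siegel p = 0 -> p = heis_o.
Proof.
move=> a0; have r0 : row_ip p.1 p.1 = 0.
  have := congr1 (ip^~ cd1) a0.
  by rewrite ipDl ipZl ip_cd1 ip_imag1 mulr1 addr0 ip0l.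
apply: heis_eq; rewrite !heisE; first exact: row_ip_eq0.
by move: a0; rewrite /siegel r0 scale0r add0r.
Qed.

Lemma gauge_eq0 p : (koranyi_gauge p == 0) = (p == heis_o).
Proof.
apply/eqP/eqP => [p0|->]; last exact: gauge0.
apply: siegel_eq0; apply/eqP; rewrite -ip_eq0 -gauge_pow4 p0 expr0n//.
Qed.

Lemma gauge_gt0 p : (0 < koranyi_gauge p) = (p != heis_o).
Proof. by rewrite lt_neqAle gauge_ge0 andbT eq_sym gauge_eq0. Qed.

Lemma koranyi_dist_ge0 p q : 0 <= koranyi_dist p q.
Proof. exact: gauge_ge0. Qed.

Lemma siegel_formC p q : siegel_form p q = cd_conj (siegel_form q p).
Proof.
rewrite /siegel_form cd_conjB (cd_conjD (siegel q)) cd_conjK cd_conjZ herm_conj.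
by rewrite [in RHS](addrC (cd_conj _)).
Qed.

Lemma koranyi_dist_eq p q p' q' :
  ip (siegel_form p q) (siegel_form p q) = ip (siegel_form p' q') (siegel_form p' q') ->
  koranyi_dist p q = koranyi_dist p' q'.
Proof.
rewrite -!koranyi_dist_pow4; apply: pow4_inj; exact: koranyi_dist_ge0.
Qed.

Lemma koranyi_distC p q : koranyi_dist p q = koranyi_dist q p.
Proof.
by apply: koranyi_dist_eq; rewrite siegel_formC ip_conj2.
Qed.

Lemma koranyi_dist_o p : koranyi_dist heis_o p = koranyi_gauge p.
Proof.
rewrite koranyi_distC /koranyi_dist; congr koranyi_gauge.
have -> : heis_inv heis_o = heis_o :> H by heis_group.
exact: heis_mulop.
Qed.

(** * Dilations *)

Definition dil r p : H :=
  (map_mx ( *:%R r) p.1, imag_part (r ^+ 2 *: (p.2 : cd R _))).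

Lemma dil1 r p i : (dil r p).1 0 i = r *: p.1 0 i.
Proof. by rewrite mxE. Qed.

Lemma dil2 r p : imag_val (dil r p).2 = r ^+ 2 *: (p.2 : cd R _).
Proof. by apply: imag_partK; rewrite cd_conjZ imag_conj scalerN. Qed.

Lemma herm_dil r p q : herm (dil r p).1 (dil r q).1 = r ^+ 2 *: herm p.1 q.1.
Proof.
rewrite scaler_sumr; apply: eq_bigr => i _.
by rewrite !dil1 cd_conjZ cd_mulZl cd_mulZr scalerA.
Qed.

Lemma dil_mul r p q : dil r (heis_mul p q) = heis_mul (dil r p) (dil r q).
Proof.
apply: heis_eq; rewrite ?(dil2, heis_mul2, herm_dil).
  by apply/rowP => i; rewrite !(heis_mul1, dil1, mxE) scalerDr.
by rewrite -scalerBr !scalerDr.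
Qed.

Lemma dil_inv r p : dil r (heis_inv p) = heis_inv (dil r p).
Proof.
apply: heis_eq; rewrite ?(dil2, heis_inv2) ?scalerN//.
by apply/rowP => i; rewrite !(heis_inv1, dil1, mxE) scalerN.
Qed.

Lemma dil_comp r s p : dil r (dil s p) = dil (r * s) p.
Proof.
apply: heis_eq; last by rewrite !dil2 scalerA -exprMn.
by apply/rowP => i; rewrite !dil1 scalerA.
Qed.

Lemma dil_id p : dil 1 p = p.
Proof.
apply: heis_eq; last by rewrite dil2 expr1n scale1r.
by apply/rowP => i; rewrite dil1 scale1r.
Qed.

Lemma dil_o r : dil r heis_o = heis_o.
Proof.
apply: heis_eq; last by rewrite dil2 heis_o2 scaler0.
by apply/rowP => i; rewrite dil1 mxE scaler0.
Qed.

Lemma dilK r : r != 0 -> cancel (dil r) (dil r^-1).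
Proof. by move=> r0 p; rewrite dil_comp mulVf// dil_id. Qed.

Lemma dilVK r : r != 0 -> cancel (dil r^-1) (dil r).
Proof. by move=> r0 p; rewrite dil_comp mulfV// dil_id. Qed.

Lemma gauge_dil r p : 0 <= r -> koranyi_gauge (dil r p) = r * koranyi_gauge p.
Proof.
move=> r0; apply: pow4_inj; rewrite ?mulr_ge0 ?gauge_ge0// exprMn !gauge_pow4.
have -> : siegel (dil r p) = r ^+ 2 *: siegel p.
  by rewrite /siegel dil2 row_ip_herm herm_dil ipZl -row_ip_herm scalerDr scalerA.
by rewrite ipZl ipZr; ring.
Qed.

Lemma koranyi_dist_dil r p q : 0 <= r ->
  koranyi_dist (dil r p) (dil r q) = r * koranyi_dist p q.
Proof. by move=> r0; rewrite /koranyi_dist -dil_inv -dil_mul gauge_dil. Qed.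

(** On horizontal elements, and on central ones in the next lemma, the dilation of
ratio 2 is a power map of the group. *)
Lemma dil2_horizontal z : dil 2 (z, 0) = heis_mul (z, 0) (z, 0).
Proof.
apply: heis_eq; last first.
  have v0 : imag_val ((z, 0) : H).2 = 0 by exact: imag_val0.
  by rewrite dil2 heis_mul2 v0 scaler0 subrr !addr0.
by apply/rowP => i; rewrite dil1 mxE scaler_nat.
Qed.

Lemma dil2_central (v : imag R (doublings K)) (p : H := (0, v)) :
  dil 2 p = heis_mul (heis_mul p p) (heis_mul p p).
Proof.
apply: heis_eq; rewrite ?dil2 !heisE.
  by apply/rowP => i; rewrite dil1 !mxE scaler0 !addr0.
by rewrite subrr /=; cd_linear.
Qed.

Lemma heis_split p : p = heis_mul (p.1, 0) (0, p.2).
Proof.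
apply: heis_eq; first by rewrite heis_mul1 /= addr0.
have v0 : imag_val ((p.1, 0) : H).2 = 0 by exact: imag_val0.
by rewrite heis_mul2 v0 [herm _.1 (p.1, _).1]herm0l herm0r subrr addr0 add0r.
Qed.

End Heisenberg.

Lemma doublings_le3 K : (doublings K <= 3)%N.
Proof. by case: K. Qed.
#[local] Hint Resolve doublings_le3 : core.

Lemma ip_sum (R : realType) m (I : Type) (s : seq I) (F : I -> cd R m) x :
  ip (\sum_(i <- s) F i) x = \sum_(i <- s) ip (F i) x.
Proof. exact: (big_morph (fun y => ip y x) (fun y z => ipDl y z x) (ip0l x)). Qed.

(** * The Koranyi inversion *)

Section Inversion.
Variables (R : realType) (K : division_algebra) (n : nat).
Notation A := (scalars R K).
Notation V := 'rV[scalars R K]_n.-1.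
Notation H := (heis R K n).
Implicit Types (z w : V) (p q g : H) (r : R) (a b u : A).

(** The sum of the squared norms of w_i - t z_i h, with h the Hermitian product, is
nonnegative; take t = 1 / |z|^2. *)
Lemma herm_cauchy z w : ip (herm z w) (herm z w) <= row_ip z z * row_ip w w.
Proof.
set h := herm z w.
have [/row_ip_eq0 z0|zn0] := eqVneq (row_ip z z) 0.
  by rewrite /h z0 herm0l ip0l mulr_ge0 ?row_ip_ge0.
have z_gt0 : 0 < row_ip z z by rewrite lt_neqAle eq_sym zn0 row_ip_ge0.
have hE : ip h h = \sum_i ip (w 0 i) (cd_mul (z 0 i) h).
  by rewrite {1}/h ip_sum; apply: eq_bigr => i _; rewrite ip_mull cd_conjK.
set t := (row_ip z z)^-1.
have : 0 <= \sum_i ip (w 0 i - t *: cd_mul (z 0 i) h) (w 0 i - t *: cd_mul (z 0 i) h).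
  by apply: sumr_ge0 => i _; exact: ip_ge0.
under eq_bigr => i _.
  rewrite ipDl !ipDr !ipNl !ipNr !ipZl !ipZr (ipC (cd_mul _ _) (w 0 i)) ip_mulM//.
  have -> (x y z0 : R) : x - t * y + (- (t * y) - - (t * (t * (z0 * ip h h)))) =
     x + - (2 * t) * y + t ^+ 2 * ip h h * z0 by ring.
over.
rewrite !big_split /= -!mulr_sumr -hE -/(row_ip w w) -/(row_ip z z).
rewrite -(ler_pM2l z_gt0) mulr0 => H0.
rewrite -subr_ge0; congr (0 <= _): H0.
by rewrite /t; field.
Qed.

Lemma row_ip_gauge p : row_ip p.1 p.1 ^+ 2 <= koranyi_gauge p ^+ 4.
Proof.
rewrite gauge_pow4 /siegel ipDl !ipDr !ipZl !ipZr ip_cd1 (ipC cd1) ip_imag1.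
by rewrite !mulr0 mulr1 !addr0 add0r -expr2 lerDl ip_ge0.
Qed.

(** A crude form of the triangle inequality, from the Cauchy inequality for the
Hermitian product; it suffices for the continuity of similarities and
inversions, at infinity too. *)
Lemma koranyi_quasi_triangle_o p q :
  koranyi_dist p q <= 2 * (koranyi_gauge p + koranyi_gauge q).
Proof.
have p0 := gauge_ge0 p; have q0 := gauge_ge0 q.
rewrite -(@ler_pXn2r _ 4) ?nnegrE ?koranyi_dist_ge0 ?mulr_ge0 ?addr_ge0//.
rewrite koranyi_dist_pow4 /siegel_form; set h := herm p.1 q.1.
have hle : ip h h <= (koranyi_gauge p ^+ 4 + koranyi_gauge q ^+ 4) / 2.
  apply: le_trans (herm_cauchy _ _) _.
  have := row_ip_gauge p; have := row_ip_gauge q.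
  have := sqr_ge0 (row_ip p.1 p.1 - row_ip q.1 q.1); nra.
have le3 (x y z : A) : ip (x + y + z) (x + y + z) <= 3 * (ip x x + ip y y + ip z z).
  have := ip_ge0 (x - y); have := ip_ge0 (y - z); have := ip_ge0 (z - x).
  rewrite !(ipDl, ipDr, ipNl, ipNr) (ipC y x) (ipC z x) (ipC z y); lra.
apply: le_trans (le3 _ _ _) _.
rewrite ipNl ipNr ipZl ipZr ip_conj2 -!gauge_pow4.
have -> : (2 * (koranyi_gauge p + koranyi_gauge q)) ^+ 4 =
  16 * (koranyi_gauge p ^+ 4 + koranyi_gauge q ^+ 4) +
  koranyi_gauge p * koranyi_gauge q * (64 * koranyi_gauge p ^+ 2 + 64 * koranyi_gauge q ^+ 2
    + 96 * koranyi_gauge p * koranyi_gauge q) by ring.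
have : 0 <= koranyi_gauge p ^+ 4 by exact: exprn_ge0.
have : 0 <= koranyi_gauge q ^+ 4 by exact: exprn_ge0.
have : 0 <= koranyi_gauge p * koranyi_gauge q * (64 * koranyi_gauge p ^+ 2 + 64 * koranyi_gauge q ^+ 2
    + 96 * koranyi_gauge p * koranyi_gauge q).
  by rewrite !(mulr_ge0, addr_ge0, exprn_ge0).
lra.
Qed.

Lemma koranyi_quasi_triangle p q g :
  koranyi_dist p q <= 2 * (koranyi_dist p g + koranyi_dist g q).
Proof.
rewrite -(koranyi_translation (heis_inv g)) (koranyi_distC g q).
exact: koranyi_quasi_triangle_o.
Qed.

Definition rmul z u : V := map_mx (fun x : A => cd_mul x u) z.

Lemma rmulE z u i : rmul z u 0 i = cd_mul (z 0 i) u.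
Proof. by rewrite mxE. Qed.

Lemma row_ip_rmul z u : row_ip (rmul z u) (rmul z u) = ip u u * row_ip z z.
Proof. by rewrite mulr_sumr; apply: eq_bigr => i _; rewrite rmulE ip_mul2r. Qed.

Lemma rmulKr z u : rmul (rmul z u) (cd_conj u) = rmul z (ip u u *: cd1).
Proof. by apply/rowP => i; rewrite !rmulE cd_mulKVr// cd_mulZr cd_mulx1. Qed.

Lemma rmul1 z : rmul z cd1 = z.
Proof. by apply/rowP => i; rewrite rmulE cd_mulx1. Qed.

(** Each summand is a scalar product of two left multiples of conj a, so the factor
a leaves the product with its squared norm. *)
Lemma herm_rmul_ip_left z w a b :
  ip (herm (rmul z a) (rmul w b)) (cd_conj a) = ip a a * ip (herm z w) (cd_conj b).
Proof.
rewrite !ip_sum mulr_sumr; apply: eq_bigr => i _.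
rewrite !rmulE cd_conjM ip_mulr cd_conjM ip_mul2l// ip_conj2.
by rewrite -ip_mulr.
Qed.

Lemma herm_rmul_ip_right z w a b :
  ip (herm (rmul z a) (rmul w b)) b = ip b b * ip (herm z w) a.
Proof.
rewrite -[b in ip _ b]cd_conjK -ip_conj herm_conj herm_rmul_ip_left.
by rewrite -ip_conj herm_conj.
Qed.

(** In terms of the Siegel coordinate a this is the map from (zeta, v) to
(- zeta (conj a)^-1, - v / |a|^2), which inverts a.  The formula sends the origin to
itself instead of infinity, which [swap_inversion] corrects. *)
Definition koranyi_inv p : H :=
  let s := (ip (siegel p) (siegel p))^-1 in
  (- rmul p.1 (s *: siegel p), imag_part (- s *: (p.2 : cd R _))).

Lemma koranyi_inv2 p :
  imag_val (koranyi_inv p).2 = - (ip (siegel p) (siegel p))^-1 *: (p.2 : cd R _).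
Proof. by apply: imag_partK; rewrite cd_conjZ imag_conj scalerN. Qed.

Lemma siegel_conj p : cd_conj (siegel p) = row_ip p.1 p.1 *: cd1 - (p.2 : cd R _).
Proof. by rewrite cd_conjD cd_conjZ cd_conj1 imag_conj. Qed.

Lemma ip_siegel_gt0 p : p != heis_o -> 0 < ip (siegel p) (siegel p).
Proof. by move=> p0; rewrite -gauge_pow4 exprn_gt0// gauge_gt0. Qed.

Lemma siegel_inv p : p != heis_o ->
  siegel (koranyi_inv p) = (ip (siegel p) (siegel p))^-1 *: cd_conj (siegel p).
Proof.
move=> /ip_siegel_gt0/lt0r_neq0 p0; rewrite siegel_conj scalerBr scalerA.
rewrite [LHS]/siegel koranyi_inv2 scaleNr; congr (_ *: _ - _).
rewrite row_ipNl row_ipNr row_ip_rmul ipZl ipZr.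
by field.
Qed.

Lemma gauge_inv p : p != heis_o -> koranyi_gauge (koranyi_inv p) = (koranyi_gauge p)^-1.
Proof.
move=> p0; apply: pow4_inj; rewrite ?invr_ge0 ?gauge_ge0// exprVn !gauge_pow4.
rewrite siegel_inv// ipZl ipZr ip_conj2.
by have := lt0r_neq0 (ip_siegel_gt0 p0); set x := ip _ _ => x0; field.
Qed.

Lemma koranyi_inv_neq0 p : p != heis_o -> koranyi_inv p != heis_o.
Proof. by move=> p0; rewrite -gauge_gt0 gauge_inv// invr_gt0 gauge_gt0. Qed.

Lemma koranyi_invK p : p != heis_o -> koranyi_inv (koranyi_inv p) = p.
Proof.
move=> p0; have := lt0r_neq0 (ip_siegel_gt0 p0) => a0.
have aE : ip (siegel (koranyi_inv p)) (siegel (koranyi_inv p)) = (ip (siegel p) (siegel p))^-1.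
  by rewrite siegel_inv// ipZl ipZr ip_conj2; field.
apply: heis_eq; last first.
  by rewrite !koranyi_inv2 aE invrK scalerA mulrNN mulfV// scale1r.
apply/rowP => i; rewrite /koranyi_inv !mxE aE invrK siegel_inv// !cd_mulNl opprK.
by rewrite !cd_mulZr cd_mulZl cd_mulKVr// scalerA mulfV// scale1r scalerA mulVf// scale1r.
Qed.

Section AssociativeOrLine.
Hypothesis n_oct : K = Octonions -> n = 2%N.

Lemma line_index : n = 2%N -> exists i0 : 'I_n.-1,
  (forall i, i = i0) /\ forall F : 'I_n.-1 -> A, \sum_i F i = F i0.
Proof.
move=> ->; exists ord0; split=> [i|F]; first exact: ord1.
exact: big_ord1.
Qed.

(** The two cases in which Hermitian products are compatible with right
multiplication of the rows: an associative algebra, or a single coordinate. *)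
Lemma assoc_or_line : (doublings K <= 2)%N \/ n = 2%N /\ K = Octonions.
Proof. by case: K n_oct => n2; [left|left|left|right; rewrite n2]. Qed.

Lemma herm_rmul_assoc z w a b : (doublings K <= 2)%N ->
  herm (rmul z a) (rmul w b) = cd_mul (cd_mul (cd_conj a) (herm z w)) b.
Proof.
move=> K2; rewrite /herm.
rewrite (big_morph (cd_mul (cd_conj a)) (fun x y => cd_mulDr x y (cd_conj a)) (cd_mulx0 (cd_conj a))).
rewrite (big_morph (fun x : A => cd_mul x b) (fun x y => cd_mulDl x y b) (cd_mul0x b)).
by apply: eq_bigr => i _; rewrite !rmulE cd_conjM !cd_mulA.
Qed.

Lemma ip_herm_rmul z w a b :
  ip (herm (rmul z a) (rmul w b)) (herm (rmul z a) (rmul w b)) =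
  ip a a * ip b b * ip (herm z w) (herm z w).
Proof.
case: assoc_or_line => [K2|[n2 _]].
  by rewrite herm_rmul_assoc// !ip_mulM// ip_conj2; ring.
have [i0 [_ sumE]] := line_index n2.
by rewrite /herm !sumE !rmulE !cd_conjM !ip_mulM// !ip_conj2; ring.
Qed.

(** Expanding the squared norm of the Siegel form of the images, the term in the
Siegel coordinates alone and the mixed and the Hermitian terms all acquire the
same factor 1 / (|a|^2 |b|^2). *)
Lemma koranyi_dist_inv p q : p != heis_o -> q != heis_o ->
  koranyi_dist (koranyi_inv p) (koranyi_inv q) =
  koranyi_dist p q / (koranyi_gauge p * koranyi_gauge q).
Proof.
move=> p0 q0; apply: pow4_inj.
- exact: koranyi_dist_ge0.
- by rewrite mulr_ge0 ?koranyi_dist_ge0// invr_ge0 mulr_ge0 ?gauge_ge0.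
rewrite exprMn exprVn exprMn !koranyi_dist_pow4 !gauge_pow4.
rewrite /siegel_form !siegel_inv// cd_conjZ cd_conjK hermNl hermNr opprK.
have a0 := lt0r_neq0 (ip_siegel_gt0 p0); have b0 := lt0r_neq0 (ip_siegel_gt0 q0).
set a := siegel p in a0 *; set b := siegel q in b0 *.
set s := (ip a a)^-1; set t := (ip b b)^-1.
have -> : herm (rmul p.1 (s *: a)) (rmul q.1 (t *: b)) =
    (s * t) *: herm (rmul p.1 a) (rmul q.1 b).
  rewrite scaler_sumr; apply: eq_bigr => i _.
  by rewrite !rmulE !cd_mulZr cd_conjZ cd_mulZl scalerA mulrC.
have hh := ip_herm_rmul p.1 q.1 a b.
have hl := herm_rmul_ip_left p.1 q.1 a b.
have hr := herm_rmul_ip_right p.1 q.1 a b.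
set h := herm p.1 q.1 in hh hl hr *; set G := herm _ _ in hh hl hr *.
clearbody a b h G.
rewrite !(ipDl, ipDr, ipNl, ipNr, ipZl, ipZr) !ip_conj2.
rewrite hh hr hl !(ipC _ G) hl hr.
rewrite (ipC a h) (ipC (cd_conj b) h) (ipC (cd_conj b) a) (ipC b) ip_conj.
by rewrite /s /t; field; rewrite a0 b0.
Qed.

End AssociativeOrLine.

(** * Rotations over an associative algebra *)

Section AssociativeRotation.
Hypothesis K2 : (doublings K <= 2)%N.
Variables (u : A) (u1 : ip u u = 1).

Definition crot (v : A) p : H :=
  (rmul p.1 v, imag_part (cd_mul (cd_mul (cd_conj v) (p.2 : cd R _)) v)).

Lemma crot2 v p :
  imag_val (crot v p).2 = cd_mul (cd_mul (cd_conj v) (p.2 : cd R _)) v.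
Proof.
apply: imag_partK; rewrite !cd_conjM cd_conjK imag_conj cd_mulA//.
by rewrite cd_mulNr cd_mulNl.
Qed.

Lemma crotK : cancel (crot u) (crot (cd_conj u)).
Proof.
move=> p; apply: heis_eq; last first.
  by rewrite !crot2 cd_conjK -!cd_mulA// cd_mul_conjr u1 scale1r cd_mulx1 cd_mulKVl// u1 scale1r.
by rewrite /crot /= rmulKr u1 scale1r rmul1.
Qed.

Lemma crot_o : crot u heis_o = heis_o.
Proof.
apply: heis_eq; last by rewrite crot2 heis_o2 cd_mulx0 cd_mul0x.
by apply/rowP => i; rewrite rmulE !mxE cd_mul0x.
Qed.

(** The right multiplication by a unit u conjugates the Siegel form by u. *)
Lemma siegel_crot p : siegel (crot u p) = cd_mul (cd_mul (cd_conj u) (siegel p)) u.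
Proof.
rewrite /siegel crot2 row_ip_rmul u1 mul1r cd_mulDr cd_mulDl cd_mulZr cd_mulZl.
by rewrite cd_mulx1 cd_mul_conjl u1 scale1r.
Qed.

Lemma koranyi_dist_crot p q : koranyi_dist (crot u p) (crot u q) = koranyi_dist p q.
Proof.
apply: koranyi_dist_eq.
have -> : siegel_form (crot u p) (crot u q) = cd_mul (cd_mul (cd_conj u) (siegel_form p q)) u.
  rewrite /siegel_form !siegel_crot herm_rmul_assoc// !cd_conjM cd_conjK cd_mulA//.
  by rewrite !(cd_mulDr, cd_mulDl, cd_mulNr, cd_mulNl, cd_mulZl, cd_mulZr).
by rewrite !ip_mulM// ip_conj2 u1 mul1r mulr1.
Qed.

End AssociativeRotation.

End Inversion.

(** * Rotations over the octonions *)

Section Reflection.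
Variables (R : realType) (m : nat) (m3 : (m <= 3)%N).
Implicit Types x y z a b u : cd R m.

Lemma cd_alternative_polar a b y :
  cd_mul a (cd_mul (cd_conj b) y) + cd_mul b (cd_mul (cd_conj a) y) =
  (2 * ip a b) *: y.
Proof.
have := cd_mulKVl m3 (a + b) y.
rewrite cd_conjD !(cd_mulDl, cd_mulDr) !cd_mulKVl// => E.
apply: ip_ext => w; have := congr1 (fun x => ip x w) E.
rewrite !(ipDl, ipDr, ipZl) (ipC b a) => {}E; lra.
Qed.

Variables (u : cd R m) (u_imag : cd_conj u = - u) (u1 : ip u u = 1).

(** On imaginary x this is conj u x u, written so that it is visibly imaginary and
needs no parentheses; on real x it is the identity. *)
Definition imag_refl x := cd_conj x + (2 * ip u x) *: u.

Lemma ip_imag_refl x : ip (imag_refl x) (imag_refl x) = ip x x.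
Proof.
rewrite /imag_refl !(ipDl, ipDr, ipZl, ipZr) ip_conj2 u1 !(ip_conj, ipC u) u_imag !ipNr.
ring.
Qed.

Lemma imag_refl_conj x : cd_conj (imag_refl x) = imag_refl (cd_conj x).
Proof.
rewrite /imag_refl cd_conjD cd_conjZ cd_conjK u_imag -ip_conj u_imag ipNl.
by rewrite mulrN scalerN scaleNr.
Qed.

Lemma imag_reflD x y : imag_refl (x + y) = imag_refl x + imag_refl y.
Proof. by rewrite /imag_refl cd_conjD ipDr mulrDr scalerDl addrACA. Qed.

(** The Moufang identity (conj u conj y) (z u) = conj u (conj y z) u for an imaginary
unit u, in weak form; it follows from the polarized alternative law. *)
Lemma ip_moufang_refl x y z :
  ip (cd_mul (cd_conj (cd_mul y u)) (cd_mul z u)) (imag_refl x) =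
  ip (cd_mul (cd_conj y) z) x.
Proof.
have snd : ip (cd_mul (cd_conj (cd_mul y u)) (cd_mul z u)) u =
   ip (cd_mul (cd_conj u) (cd_conj y)) (cd_conj z).
  by rewrite ip_mulr cd_conjM cd_conjM cd_mulKVl// u1 scale1r.
have fst : ip (cd_mul (cd_conj (cd_mul y u)) (cd_mul z u)) (cd_conj x) =
   ip (cd_mul (cd_conj y) z) x -
   2 * ip u x * ip (cd_mul (cd_conj u) (cd_conj y)) (cd_conj z).
  rewrite ip_mulr !cd_conjM.
  have := cd_alternative_polar (cd_conj x) u (cd_conj z).
  rewrite cd_conjK => /(canRL (addrK _)) ->.
  rewrite ipDr ipNr ipZr u_imag cd_mulNl !ipNl ip_mul2l// u1 mul1r.
  rewrite ip_conj u_imag ipNr (ipC x) (ip_mulr (cd_conj y)); ring.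
rewrite /imag_refl ipDr ipZr fst snd; ring.
Qed.

End Reflection.

Section Rotation.
Variables (R : realType) (K : division_algebra) (n : nat).
Notation A := (scalars R K).
Notation V := 'rV[scalars R K]_n.-1.
Notation H := (heis R K n).
Implicit Types (z w : V) (p q g : H) (r : R) (a b u : A).

Section MoufangRotation.
Hypothesis n2 : n = 2%N.
Variables (u : A) (u_imag : cd_conj u = - u) (u1 : ip u u = 1).

(** The generators of the action of Spin(7) on the octonionic Heisenberg group: the
spin representation acts on zeta and the vector representation on v. *)
Definition mrot u p : H := (rmul p.1 u, imag_part (imag_refl u (p.2 : cd R _))).

Lemma mrot1 p : (mrot u p).1 = rmul p.1 u.
Proof. by []. Qed.

Lemma mrot2 p : imag_val (mrot u p).2 = (2 * ip u (p.2 : cd R _)) *: u - (p.2 : cd R _).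
Proof.
rewrite imag_partK.
  by rewrite /imag_refl imag_conj addrC.
by rewrite imag_refl_conj// /imag_refl cd_conjK imag_conj ipNr mulrN scaleNr opprD opprK.
Qed.

Lemma mrot_o : mrot u heis_o = heis_o.
Proof.
apply: heis_eq; last by rewrite mrot2 heis_o2 ip0r mulr0 scale0r subr0.
by apply/rowP => i; rewrite rmulE !mxE cd_mul0x.
Qed.

Lemma siegel_mrot p : siegel (mrot u p) = imag_refl u (siegel p).
Proof.
rewrite /siegel mrot2 row_ip_rmul u1 mul1r imag_reflD.
rewrite /imag_refl imag_conj cd_conjZ cd_conj1 ipZr ip_imag_one// !mulr0 scale0r addr0.
by rewrite [- _ + _]addrC.
Qed.

Lemma koranyi_dist_mrot p q : koranyi_dist (mrot u p) (mrot u q) = koranyi_dist p q.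
Proof.
have [i0 [_ sumE]] := line_index R K n2.
apply: koranyi_dist_eq; rewrite /siegel_form !siegel_mrot imag_refl_conj//.
rewrite -imag_reflD /herm !sumE !rmulE.
set c := siegel p + cd_conj (siegel q); set y := p.1 0 i0; set z := q.1 0 i0.
have cH := ip_moufang_refl (doublings_le3 K) u_imag u1 c y z.
have HH : ip (cd_mul (cd_conj (cd_mul y u)) (cd_mul z u))
    (cd_mul (cd_conj (cd_mul y u)) (cd_mul z u)) =
    ip (cd_mul (cd_conj y) z) (cd_mul (cd_conj y) z).
  by rewrite !ip_mulM// !ip_conj2 !ip_mulM// u1 !mulr1.
have cc := ip_imag_refl u_imag u1 c.
set G := cd_mul _ _ in cH HH *; set h := cd_mul _ _ in cH HH *.
set c' := imag_refl _ _ in cc cH *; clearbody c c' h G.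
rewrite !(ipDl, ipDr, ipNl, ipNr, ipZl, ipZr) (ipC c') (ipC c) cH HH cc; ring.
Qed.

End MoufangRotation.

Lemma mrotK u : n = 2%N -> cd_conj u = - u -> ip u u = 1 -> cancel (mrot u) (mrot (- u)).
Proof.
move=> n2 u_imag u1 p; have u1' : ip (- u) (- u) = 1 by rewrite ipNl ipNr opprK.
have u_imag' : cd_conj (- u) = - - u by rewrite cd_conjN u_imag.
apply: heis_eq; last first.
  rewrite !mrot2// ipDr ipZr ipNl u1 ipNr ipNl.
  by apply: ip_ext => w; rewrite !(ipDl, ipNl, ipZl); ring.
by rewrite /mrot /= -{1}u_imag rmulKr u1 scale1r rmul1.
Qed.

Lemma koranyi_inv_unit p : ip (siegel p) (siegel p) = 1 ->
  (koranyi_inv p).1 = - rmul p.1 (siegel p) /\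
  imag_val (koranyi_inv p).2 = - (p.2 : cd R _).
Proof.
by move=> a1; rewrite koranyi_inv2 a1 invr1 scaleN1r /koranyi_inv /= a1 invr1 scale1r.
Qed.

Lemma rmulN z u : rmul (- z) u = - rmul z u.
Proof. by apply/rowP => i; rewrite !mxE cd_mulNl. Qed.

(** Bijectivity is part of the definition because a Mobius map is a homeomorphism. *)
Definition isometry_o f := exists f' : H -> H,
  [/\ cancel f f', cancel f' f,
      forall p q, koranyi_dist (f p) (f q) = koranyi_dist p q & f heis_o = heis_o].

Lemma isometry_o_comp f (g : H -> H) : isometry_o f -> isometry_o g -> isometry_o (f \o g).
Proof.
move=> [f' [fK fK' fi fo]] [g' [gK gK' gi go]]; exists (g' \o f'); split.
- by move=> p; rewrite /comp fK gK.
- by move=> p; rewrite /comp gK' fK'.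
- by move=> p q; rewrite /comp fi gi.
- by rewrite /comp go fo.
Qed.

Lemma isometry_o_crot u : (doublings K <= 2)%N -> ip u u = 1 -> isometry_o (crot u : H -> H).
Proof.
move=> K2 u1; exists (crot (cd_conj u)); split.
- exact: crotK.
- have u1' : ip (cd_conj u) (cd_conj u) = 1 by rewrite ip_conj2.
  by move=> p; have := crotK K2 u1' p; rewrite cd_conjK.
- exact: koranyi_dist_crot.
- exact: crot_o.
Qed.

Lemma isometry_o_mrot u : n = 2%N -> cd_conj u = - u -> ip u u = 1 ->
  isometry_o (mrot u : H -> H).
Proof.
move=> n2 uN u1; exists (mrot (- u)); split.
- exact: mrotK.
- have u1' : ip (- u) (- u) = 1 by rewrite ipNl ipNr opprK.
  have uN' : cd_conj (- u) = - - u by rewrite cd_conjN uN.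
  by move=> p; have := mrotK n2 uN' u1' p; rewrite opprK.
- exact: koranyi_dist_mrot.
- exact: mrot_o.
Qed.

(** Here I p = (- zeta a, - v), and conj a commutes with v. *)
Lemma rotation_assoc p : (doublings K <= 2)%N -> ip (siegel p) (siegel p) = 1 ->
  crot (cd_conj (siegel p)) (koranyi_inv p) = heis_inv p.
Proof.
move=> K2 a1; have [i1 i2] := koranyi_inv_unit a1.
apply: heis_eq.
  by rewrite (_ : (crot _ _).1 = rmul (koranyi_inv p).1 (cd_conj (siegel p)))// i1 rmulN rmulKr a1 scale1r rmul1.
rewrite crot2// i2 cd_conjK heis_inv2 cd_mulNr cd_mulNl; congr (- _).
have -> : cd_mul (siegel p) (p.2 : cd R _) = cd_mul (p.2 : cd R _) (siegel p).
  by rewrite /siegel cd_mulDl cd_mulDr cd_mulZl cd_mulZr cd_mul1x cd_mulx1.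
by rewrite cd_mulKVr// a1 scale1r.
Qed.

(** A rotation by an imaginary unit u orthogonal to v changes the sign of v; so two of
them fix v.  The second unit w is determined by ((zeta a) u) w = zeta, and it
is again imaginary and orthogonal to v because u is orthogonal to 1 and v. *)
Lemma rotation_line p u : n = 2%N -> ip (siegel p) (siegel p) = 1 -> p.1 != 0 ->
  cd_conj u = - u -> ip u u = 1 -> ip u (p.2 : cd R _) = 0 ->
  exists w : A, [/\ cd_conj w = - w, ip w w = 1 & mrot w (mrot u (koranyi_inv p)) = heis_inv p].
Proof.
move=> n2 a1 p0 uN u1 uv; have [i1 i2] := koranyi_inv_unit a1.
have [i0 [i0E sumE]] := line_index R K n2.
set a := siegel p in a1 *; set z := p.1 0 i0; set v := imag_val p.2 in uv *.
have z0 : ip z z != 0.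
  apply: contraNneq p0 => /eqP; rewrite ip_eq0 => /eqP zE.
  by apply/eqP/rowP => i; rewrite (i0E i) mxE.
have ua : ip a u = 0.
  by rewrite /a /siegel ipDl ipZl ipC ip_imag_one// mulr0 add0r ipC.
pose x := cd_mul (cd_mul z a) u.
pose w := (ip z z)^-1 *: cd_conj (cd_mul (cd_conj z) x).
have xw : x = cd_mul z (cd_conj w).
  by rewrite /w cd_conjZ cd_conjK cd_mulZr cd_mulKVl// scalerA mulVf// scale1r.
have w1 : ip w w = 1.
  rewrite ipZl ipZr ip_conj2 !ip_mulM// ip_conj2 a1 u1; field.
  by rewrite z0.
have wI : ip w cd1 = 0.
  rewrite ipZl ip_conj cd_conj1 ip_mull cd_conjK cd_mulx1 /x ip_mulr uN cd_mulNr ipNr.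
  by rewrite ip_mul2l// ua !(mulr0, oppr0).
have wN : cd_conj w = - w.
  by apply/eqP; rewrite -addr_eq0 addrC cd_trace wI mulr0 scale0r.
have wv : ip w v = 0.
  rewrite ipZl ip_conj imag_conj ipNr ip_mull cd_conjK /x.
  rewrite {1}/a /siegel cd_mulDr cd_mulZr cd_mulx1 cd_mulDl cd_mulZl ipDl ipZl.
  rewrite ip_mul2l// uv -[X in ip (cd_mul _ u) X]cd_mulx1 ip_mul2l// ip_imag_one//.
  by rewrite !(mulr0, addr0, oppr0).
exists w; split=> //; apply: heis_eq; last first.
  rewrite !mrot2// i2 ipNr -/v uv oppr0 mulr0 scale0r sub0r opprK wv mulr0 scale0r sub0r.
  by rewrite heis_inv2.
rewrite !mrot1 i1 !rmulN heis_inv1; congr (- _); apply/rowP => i.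
rewrite (i0E i) !rmulE -/z -/a -/x xw cd_mulKr// w1 scale1r //.
Qed.

Lemma ip_pair m (x1 x2 y1 y2 : cd R m) :
  @ip R m.+1 (x1, x2) (y1, y2) = ip x1 y1 + ip x2 y2.
Proof. by []. Qed.

(** Two orthonormal imaginary units span a plane, which meets the orthogonal
complement of v. *)
Lemma imag_orthogonal m (v : cd R m.+2) :
  exists u : cd R m.+2, [/\ cd_conj u = - u, ip u u = 1 & ip u v = 0].
Proof.
pose e1 : cd R m.+2 := ((0 : cd R m.+1), @cd1 R m.+1).
pose e2 : cd R m.+2 := ((0 : cd R m.+1), ((0 : cd R m), @cd1 R m) : cd R m.+1).
have eN (x : cd R m.+1) : @cd_conj R m.+2 (0, x) = - ((0, x) : cd R m.+2).
  have -> : - ((0, x) : cd R m.+2) = (- 0, - x) by [].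
  by rewrite -[LHS]/(cd_conj (0 : cd R m.+1), - x) cd_conj0 oppr0.
have e11 : ip e1 e1 = 1 by rewrite ip_pair ip0l ip_cd1 add0r.
have e22 : ip e2 e2 = 1.
  by rewrite !ip_pair !ip0l ip_cd1 !add0r.
have e12 : ip e1 e2 = 0.
  by rewrite !ip_pair !ip0l ip0r !add0r.
have [v1|v1] := eqVneq (ip e1 v) 0; first by exists e1; split => //; exact: eN.
pose x := ip e2 v *: e1 - ip e1 v *: e2.
have xN : cd_conj x = - x.
  by rewrite /x cd_conjB !cd_conjZ !eN !scalerN opprB opprK addrC.
have xx : ip x x = ip e2 v ^+ 2 + ip e1 v ^+ 2.
  by rewrite /x !(ipDl, ipDr, ipNl, ipNr, ipZl, ipZr) (ipC e2 e1) e11 e22 e12; ring.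
have x_gt0 : 0 < ip x x by rewrite xx ltr_wpDl ?sqr_ge0// exprn_even_gt0.
exists ((Num.sqrt (ip x x))^-1 *: x); split.
- by rewrite cd_conjZ xN scalerN.
- rewrite ipZl ipZr mulrA -invfM -expr2 sqr_sqrtr ?ltW// mulVf// lt0r_neq0//.
- have xv : ip x v = 0 by rewrite /x ipDl ipNl !ipZl; ring.
  by rewrite ipZl xv mulr0.
Qed.

(** The rotations about o need not be transitive on the unit sphere, but their orbits
cannot separate I p from the inverse of p. *)
Lemma koranyi_inv_rotation p : (K = Octonions -> n = 2%N) -> koranyi_gauge p = 1 ->
  exists2 f : H -> H, isometry_o f & f (koranyi_inv p) = heis_inv p.
Proof.
move=> n_oct p1; have a1 : ip (siegel p) (siegel p) = 1 by rewrite -gauge_pow4 p1 expr1n.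
have [K2|[n2 KO]] := assoc_or_line n_oct.
  exists (crot (cd_conj (siegel p))); last exact: rotation_assoc.
  by apply: isometry_o_crot => //; rewrite ip_conj2.
have [p0|p0] := eqVneq p.1 0.
  exists id; first by exists id; split.
  have [i1 i2] := koranyi_inv_unit a1.
  apply: heis_eq; last by rewrite i2 heis_inv2.
  by rewrite i1 heis_inv1 p0; apply/rowP => i; rewrite !mxE cd_mul0x.
have [u [uN u1 uv]] : exists u : A, [/\ cd_conj u = - u, ip u u = 1 & ip u (p.2 : cd R _) = 0].
  by case: (p) => _ v /=; subst K; exact: imag_orthogonal.
have [w [wN w1 wp]] := rotation_line n2 a1 p0 uN u1 uv.
exists (mrot w \o mrot u); last exact: wp.
by apply: isometry_o_comp; apply: isometry_o_mrot.
Qed.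

End Rotation.

(** * Similarities and inversions as Mobius maps *)

Section MobiusMaps.
Variables (R : realType) (S : choiceType) (o : S) (k : S -> S -> R).

Lemma ext_openP (U : set (ext_space o k)) : open U = ext_open U.
Proof. by []. Qed.

(** Each of the four points contributes its weight once to a numerator and once to a
denominator of the cross-ratio.  Two weight functions are used because each
factor pairs one of p3, p4 with one of p1, p2. *)
Lemma cross_ratio_weights (F : option S -> option S) (u v : option S -> R) :
  (forall p, u p != 0) -> (forall p, v p != 0) ->
  (forall p q, p != q -> cr_factor k (F p) (F q) = u p * v q * cr_factor k p q) ->
  forall p1 p2 p3 p4, uniq [:: p1; p2; p3; p4] ->
    cross_ratio k (F p1) (F p2) (F p3) (F p4) = cross_ratio k p1 p2 p3 p4.
Proof.
move=> u0 v0 FE p1 p2 p3 p4 /=; rewrite !inE !negb_or.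
move=> /and4P[/and3P[n12 n13 n14] /andP[n23 n24] n34 _].
rewrite /cross_ratio !FE ?(eq_sym p4) ?(eq_sym p3)//.
rewrite !invfM.
have -> (a b c x e1 e2 e3 e4 a' b' c' x' : R) :
    a * b * e1 * (a' * c' * e2) * (x * c * e3 * (x' * b' * e4)) =
    (a * a') * (b * b') * (c * c') * (x * x') * (e1 * e2 * (e3 * e4)) by ring.
by rewrite !mulfV// !mul1r.
Qed.

Hypothesis k_ge0 : forall x y, 0 <= k x y.
Hypothesis kC : forall x y, k x y = k y x.
Hypothesis k_tri : forall x y z, k x z <= 2 * (k x y + k y z).

Lemma similarity_continuous f r : 0 < r ->
  (forall x y, k (f x) (f y) = r * k x y) ->
  continuous (omap f : ext_space o k -> ext_space o k).
Proof.
move=> r0 fr; apply/continuousP => U; rewrite !ext_openP => -[US UN]; split.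
  move=> x /US[e e0 eU]; exists (e / r); first exact: divr_gt0.
  by move=> y; rewrite ltr_pdivlMr// mulrC -fr; exact: eU.
move=> /UN[e e0 eU]; exists (2 * (k (f o) o + e) / r).
  by rewrite divr_gt0// mulr_gt0// ltr_wpDl.
move=> y; rewrite ltr_pdivrMr// mulrC -mulrC (mulrC _ r) -fr => ey; apply: eU.
have := k_tri (f o) o (f y); lra.
Qed.

Lemma similarity_mobius f f' r : cancel f f' -> cancel f' f -> 0 < r ->
  (forall x y, k (f x) (f y) = r * k x y) -> mobius o k (omap f).
Proof.
move=> fK fK' r0 fr; split.
  exists (omap f'); split.
  - by case=> //= x; rewrite fK.
  - by case=> //= x; rewrite fK'.
  - exact: similarity_continuous fr.
  - apply: (@similarity_continuous f' r^-1); first by rewrite invr_gt0.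
    by move=> x y; rewrite -{2}(fK' x) -{2}(fK' y) fr mulKf// lt0r_neq0.
(* A factor containing infinity stays 1, so the two weights must multiply to r on
   finite points and to 1 as soon as one point is infinite. *)
apply: (@cross_ratio_weights _ (fun p => if p is Some _ then r else 1)
                           (fun p => if p is Some _ then 1 else r^-1)).
- by case=> *; rewrite ?oner_neq0// lt0r_neq0.
- by case=> *; rewrite ?oner_neq0// invr_neq0// lt0r_neq0.
- by case=> [x|] [y|] //= _; rewrite ?fr ?mulr1// mulfV// lt0r_neq0.
Qed.

Variable i : S -> S.
Hypothesis k_gt0 : forall x, x != o -> 0 < k o x.
Hypothesis koo : k o o = 0.
Hypothesis io : forall x, x != o -> i x != o.
Hypothesis iK : forall x, x != o -> i (i x) = x.
Hypothesis ki : forall x, x != o -> k o (i x) = (k o x)^-1.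
Hypothesis kii : forall x y, x != o -> y != o ->
  k (i x) (i y) = k x y / (k o x * k o y).

(** The extension of i to infinity: the value of i at o is discarded. *)
Definition swap_inversion (p : option S) : option S :=
  if p is Some x then if x == o then None else Some (i x) else Some o.

Lemma swap_inversionK : involutive swap_inversion.
Proof.
case=> [x|] /=; last by rewrite eqxx.
have [->//|x0] := eqVneq x o.
by rewrite /= (negbTE (io x0)) iK.
Qed.

(** Near a finite point x other than o, the distance of the images is at most
k x y times 4 / (k o x)^2: the constant 2 of the quasi-triangle inequality
bounds k o y below by k o x / 4. *)
Lemma swap_inversion_continuous :
  continuous (swap_inversion : ext_space o k -> ext_space o k).
Proof.
apply/continuousP => U; rewrite !ext_openP => -[US UN]; split.
  move=> x; rewrite /preimage/=; have [->|x0] := eqVneq x o.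
    move=> UNone; have [e e0 eU] := UN UNone.
    exists e^-1; first by rewrite invr_gt0.
    move=> y ye; case: eqVneq => [//|y0]; apply: eU.
    by rewrite ki// -[e]invrK ltf_pV2 ?posrE ?invr_gt0 ?k_gt0.
  move=> /US[e e0 eU]; have kx := k_gt0 x0.
  exists (Num.min (k o x / 4) (e * k o x ^+ 2 / 4)).
    by rewrite lt_min !divr_gt0 ?mulr_gt0 ?exprn_gt0.
  move=> y; rewrite lt_min => /andP[xy1 xy2].
  have ky : k o x / 4 <= k o y by have := k_tri o y x; rewrite (kC y x); lra.
  have y0 : y != o.
    by apply/eqP => yo; move: xy1; rewrite yo kC; lra.
  rewrite (negbTE y0); apply: eU; rewrite kii// ltr_pdivrMr ?mulr_gt0 ?k_gt0//.
  apply: lt_le_trans xy2 _; rewrite -mulrA ler_pM2l// expr2 -mulrA ler_pM2l//.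
move=> /= /US[e e0 eU]; exists e^-1; first by rewrite invr_gt0.
move=> y ye; rewrite /preimage/=; have y0 : y != o.
  apply: contraTneq ye => ->; rewrite koo -leNgt invr_ge0 ltW//.
rewrite (negbTE y0); apply: eU.
by rewrite ki// -[e]invrK ltf_pV2 ?posrE ?invr_gt0 ?k_gt0.
Qed.

Lemma swap_inversion_mobius : mobius o k swap_inversion.
Proof.
split.
  exists swap_inversion; split; try exact: swap_inversionK;
  exact: swap_inversion_continuous.
pose w (p : option S) := if p is Some x then if x == o then 1 else (k o x)^-1 else 1.
have w0 p : w p != 0.
  rewrite /w; case: p => [x|]; rewrite ?oner_neq0//.
  case: (eqVneq x o) => [_|x0]; first exact: oner_neq0.
  by rewrite invr_eq0 lt0r_neq0 ?k_gt0.
apply: (@cross_ratio_weights _ w w) => // -[x|] [y|] //=.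
- case: (eqVneq x o) => [->|x0]; case: (eqVneq y o) => [->|y0] //= xy.
  + by rewrite eqxx in xy.
  + by rewrite mul1r mulVf// lt0r_neq0 ?k_gt0.
  + by rewrite mulr1 (kC x) mulVf// lt0r_neq0 ?k_gt0.
  + by rewrite kii// invfM mulrC.
- by case: (eqVneq x o) => //= x0; rewrite ?mulr1// kC ki.
- by case: (eqVneq y o) => //= y0; rewrite ?mul1r ?mulr1// ki.
Qed.

End MobiusMaps.

(** * Mobius maps of a metric space *)

Section MobiusMetric.
Variables (R : realType) (S : choiceType) (o : S) (d : S -> S -> R).
Hypothesis d_metric : is_metric d.

Lemma metric_gt0 x y : x != y -> 0 < d x y.
Proof.
case: d_metric => d_ge0 d_eq0 _ _ xy; rewrite lt_neqAle d_ge0 andbT eq_sym.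
by apply: contraNneq xy => /d_eq0 ->.
Qed.

Lemma metricC x y : d x y = d y x.
Proof. by case: d_metric. Qed.

Lemma metric0 x : d x x = 0.
Proof. by case: d_metric => _ h _ _; apply/h. Qed.

(** With the last point at infinity the cross-ratio is d x y / d x z, so the dilation
ratio Q is the same on all pairs that share a point. *)
Lemma mobius_similarity f : injective f -> mobius o d (omap f) ->
  exists2 c, 0 < c & forall x y, d (f x) (f y) = c * d x y.
Proof.
move=> f_inj [_ cr].
have fN x y : x != y -> 0 < d (f x) (f y).
  by move=> xy; apply: metric_gt0; apply: contraNneq xy => /f_inj ->.
pose Q x y := d (f x) (f y) / d x y.
have QC x y : Q x y = Q y x by rewrite /Q !(metricC y) !(metricC _ (f x)).
have Qz x y z : x != y -> x != z -> Q x y = Q x z.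
  move=> xy xz; have [->//|yz] := eqVneq y z.
  have := cr (Some y) (Some z) (Some x) None.
  have u : uniq [:: Some y; Some z; Some x; None].
    by rewrite /= !inE /= !negb_or !(inj_eq Some_inj) yz (eq_sym y) (eq_sym z) xy xz.
  move/(_ u).
  rewrite /cross_ratio /= divr1 !mul1r => E.
  have := metric_gt0 xy; have := metric_gt0 xz; have := fN _ _ xz.
  move=> /lt0r_neq0 h1 /lt0r_neq0 h2 /lt0r_neq0 h3.
  rewrite /Q; apply/eqP; rewrite eqr_div//; apply/eqP.
  move/eqP: E; rewrite eqr_div// => /eqP ->; ring.
have [[[x0 y0] /= xy0]|nxy] := pselect (exists xy : S * S, xy.1 != xy.2); last first.
  exists 1 => // x y; rewrite mul1r.
  suff -> : x = y by rewrite !metric0.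
  by apply/eqP/negPn/negP => xy; apply: nxy; exists (x, y).
have xy0' : y0 != x0 by rewrite eq_sym.
exists (Q x0 y0) => [|x y]; first by rewrite divr_gt0 ?fN ?metric_gt0.
have [->|xy] := eqVneq x y; first by rewrite !metric0 mulr0.
suff <- : Q x y = Q x0 y0 by rewrite /Q divfK// lt0r_neq0// metric_gt0.
have [xE|xy0''] := eqVneq x y0; first by rewrite (QC x0) -xE; apply: Qz; rewrite // xE.
by rewrite (Qz _ _ _ xy xy0'') QC (QC x0); apply: Qz => //; rewrite eq_sym.
Qed.

(** Compare the cross-ratio of o, infinity, x and y, which is the quotient of d o x
by d o y, with that of the images. *)
Lemma mobius_swap_inversion i : (forall x, x != o -> i x != o) ->
  mobius o d (swap_inversion o i) ->
  exists c, forall x, x != o -> d o x * d o (i x) = c.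
Proof.
move=> io [_ cr].
have E x y : x != o -> y != o -> d o x * d o (i x) = d o y * d o (i y).
  move=> x0 y0; have [->//|xy] := eqVneq x y.
  have := cr (Some o) None (Some x) (Some y).
  have u : uniq [:: Some o; None; Some x; Some y].
    by rewrite /= !inE /= !negb_or !(inj_eq Some_inj) xy !(eq_sym o) x0 y0.
  move/(_ u).
  rewrite /cross_ratio /= eqxx (negbTE x0) (negbTE y0) /= !divr1 !mul1r.
  rewrite !(metricC _ o) => E.
  have := metric_gt0 x0; have := metric_gt0 y0.
  have := metric_gt0 (io x x0); have := metric_gt0 (io y y0).
  rewrite !(metricC _ o).
  move=> /lt0r_neq0 h1 /lt0r_neq0 h2 /lt0r_neq0 h3 /lt0r_neq0 h4.
  rewrite [X in _ = X]mulrC in E.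
  by move/eqP: E; rewrite eqr_div// => /eqP; rewrite mulrC => <-; rewrite mulrC.
have [[x x0]|nx] := pselect (exists x, x != o).
  by exists (d o x * d o (i x)) => y y0; exact: E.
by exists 0 => x x0; case: nx; exists x.
Qed.

End MobiusMetric.

(** * Monotone multiplicative functions *)

Section RealFunctions.
Variable R : realType.

Lemma small_power (x e : R) : 0 <= x < 1 -> 0 < e -> exists j : nat, x ^+ j < e.
Proof.
move=> /andP[x0 x1] e0.
have /cvgrPdist_lt/(_ e e0)[N _ /(_ N (leqnn N))] := @cvg_expr R x ltac:(by rewrite ger0_norm).
by rewrite sub0r normrN ger0_norm ?exprn_ge0//; exists N.
Qed.

(** With m the integer part of n t, both n g(t) and n t g(1) lie between m g(1) and
(m + 1) g(1), so g(t) and t g(1) differ by at most g(1) / n. *)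
Lemma additive_linear (g : R -> R) :
  (forall s t, g (s + t) = g s + g t) -> (forall t, 0 < t -> 0 < g t) ->
  forall t, g t = t * g 1.
Proof.
move=> gD gpos.
have g0 : g 0 = 0 by have := gD 0 0; rewrite addr0; lra.
have gN t : g (- t) = - g t by have := gD t (- t); rewrite subrr g0; lra.
have gn n t : g (n%:R * t) = n%:R * g t.
  elim: n => [|n IH]; first by rewrite !mul0r.
  by rewrite -addn1 natrD !mulrDl gD IH !mul1r.
have gle s t : s <= t -> g s <= g t.
  rewrite le_eqVlt => /predU1P[->//|st].
  have := gD s (t - s); rewrite subrKC => ->.
  by rewrite lerDl ltW// gpos// subr_gt0.
have pos t : 0 < t -> g t = t * g 1.
  move=> t0; apply/eqP; rewrite -subr_eq0 -normr_eq0.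
  set e := `|_|; apply/negPn/negP => e0.
  have e_gt0 : 0 < e by rewrite lt_neqAle eq_sym e0 normr_ge0.
  have a0 : 0 < g 1 by exact: gpos.
  have := archi_boundP (ltW (divr_gt0 a0 e_gt0)); set n := Num.Def.archi_bound _.
  rewrite ltr_pdivrMr// => ne.
  have nt0 : 0 <= n%:R * t by rewrite mulr_ge0// ltW.
  have /andP[m1 m2] := truncn_itv nt0.
  set m := Num.Def.trunc _ in m1 m2.
  have := gle _ _ m1; have := gle _ _ (ltW m2).
  rewrite gn -(mulr1 m%:R) -(mulr1 m.+1%:R) !gn => h1 h2.
  have : n%:R * e <= g 1.
    have k1 := ler_wpM2r (ltW a0) m1; have k2 := ler_wpM2r (ltW a0) (ltW m2).
    rewrite -[n%:R]ger0_norm// -normrM ler_norml.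
    by move: h2 k2; rewrite -natr1 => h2 k2; apply/andP; split; lra.
  by rewrite leNgt ne.
move=> t; have [t0|t0|->] := ltgtP t 0.
- by have := pos (- t); rewrite oppr_gt0 gN => /(_ t0); lra.
- exact: pos.
- by rewrite g0 mul0r.
Qed.

Lemma multiplicative_powR (mu : R -> R) :
  (forall r, 0 < r -> 0 < mu r) ->
  (forall r s, 0 < r -> 0 < s -> mu (r * s) = mu r * mu s) ->
  (forall r, 0 < r -> r < 1 -> mu r < 1) ->
  exists2 alpha, 0 < alpha & forall r, 0 < r -> mu r = r `^ alpha.
Proof.
move=> mu0 dil_ratioM mu1; pose g t := ln (mu (expR t)).
have gD s t : g (s + t) = g s + g t.
  by rewrite /g expRD dil_ratioM ?expR_gt0// lnM ?posrE ?mu0 ?expR_gt0.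
have g0 : g 0 = 0 by have := gD 0 0; rewrite addr0; lra.
have gpos t : 0 < t -> 0 < g t.
  move=> t0; have : g (- t) < 0.
    by rewrite /g ln_lt0// mu0 ?expR_gt0//= mu1 ?expR_gt0// expR_lt1 oppr_lt0.
  by have := gD t (- t); rewrite subrr g0; lra.
exists (g 1) => [|r r0]; first exact: gpos.
rewrite /powR gt_eqF// mulrC -(additive_linear gD gpos) /g.
by rewrite !lnK ?posrE ?mu0 ?lnK ?posrE.
Qed.

End RealFunctions.

(** * Rigidity of the metric *)

Section Rigidity.
Variables (R : realType) (K : division_algebra) (n : nat).
Hypotheses (n_ge2 : (2 <= n)%N) (n_oct : K = Octonions -> n = 2%N).
Notation A := (scalars R K).
Notation H := (heis R K n).
Notation o := (heis_o : H).
Notation k := (@koranyi_dist R K n).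
Variable d : H -> H -> R.
Hypothesis d_metric : is_metric d.
Hypothesis same_topology : ext_topology o d = ext_topology o k.
Hypothesis same_mobius : mobius o d = mobius o k.
Implicit Types (p q g x y : H) (r : R) (f : H -> H).

Definition scales f c := forall x y, d (f x) (f y) = c * d x y.

(** A d-ball about o is open in both topologies. *)
Lemma small_gauge_small_dist (e : R) : 0 < e ->
  exists2 e', 0 < e' & forall y, koranyi_gauge y < e' -> d o y < e.
Proof.
move=> e0; pose U : set (option H) := [set p | if p is Some y then d o y < e else False].
have : ext_topology o d U.
  split=> [x|[]] /=; rewrite /U/= => xe.
  exists (e - d o x); first by rewrite subr_gt0.
  case: d_metric => _ _ _ tri y; have := tri o x y; lra.
rewrite same_topology => -[+ _] => /(_ o).
rewrite /U /= metric0// => /(_ e0)[e' e'0 H'].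
by exists e' => // y ye; apply: H'; rewrite koranyi_dist_o.
Qed.

Lemma similarity_scales f f' r : cancel f f' -> cancel f' f -> 0 < r ->
  (forall x y, k (f x) (f y) = r * k x y) -> exists2 c, 0 < c & scales f c.
Proof.
move=> fK fK' r0 fr.
have : mobius o k (omap f).
  apply: similarity_mobius fK fK' r0 fr.
  - exact: koranyi_dist_ge0.
  - by move=> x y z; exact: koranyi_quasi_triangle.
rewrite -same_mobius => /(mobius_similarity d_metric); apply.
exact: can_inj fK.
Qed.

(** A reference point, available since n is at least 2; it is horizontal so that its
square is its dilate of ratio 2. *)
Definition horizontal_point : H := (\row_i (cd1 : A), 0).

Lemma horizontal_point_neq0 : horizontal_point != o.
Proof.
apply/eqP => /(congr1 fst)/rowP.
have n0 : (0 < n.-1)%N by rewrite -subn1 subn_gt0.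
move=> /(_ (Ordinal n0)); rewrite !mxE => /(congr1 (fun x : A => ip x cd1)).
by rewrite ip_cd1 ip0l => /eqP; rewrite oner_eq0.
Qed.

Lemma scales_uniq f c c' : scales f c -> scales f c' -> c = c'.
Proof.
move=> fc fc'; have e0 : d o horizontal_point != 0.
  by rewrite lt0r_neq0// metric_gt0// eq_sym; exact: horizontal_point_neq0.
by have := fc o horizontal_point; rewrite fc' => /(mulIf e0).
Qed.

Lemma scales_comp f (g' : H -> H) c c' : scales f c -> scales g' c' -> scales (f \o g') (c * c').
Proof. by move=> fc gc x y; rewrite /= fc gc mulrA. Qed.

Lemma translation_scales g : exists2 c, 0 < c & scales (heis_mul g) c.
Proof.
apply: (similarity_scales (heis_mulK g) (heis_mulVK g) ltr01) => x y.
by rewrite mul1r koranyi_translation.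
Qed.

Lemma dil_scales r : 0 < r -> exists2 c, 0 < c & scales (dil r) c.
Proof.
move=> r0; apply: (similarity_scales (dilK (lt0r_neq0 r0)) (dilVK (lt0r_neq0 r0)) r0).
by move=> x y; rewrite koranyi_dist_dil// ltW.
Qed.

Lemma translation_dil_scales g c c' : scales (heis_mul g) c ->
  scales (heis_mul (dil 2 g)) c' -> c = c'.
Proof.
move=> gc gc'; have [c2 c20 s2] := @dil_scales 2 ltac:(by []).
have h1 := scales_comp s2 gc; have h2 := scales_comp gc' s2.
apply: (mulfI (lt0r_neq0 c20)); rewrite [RHS]mulrC.
by apply: scales_uniq h1 _ => x y; have := h2 x y; rewrite /= !dil_mul.
Qed.

(** The ratio c of the translation by a horizontal g satisfies c = c^2, that by a
central g satisfies c = c^4, and every g is a product of such elements. *)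
Lemma translation_isometry g : scales (heis_mul g) 1.
Proof.
have [c1 c10 s1] := translation_scales (g.1, 0).
have [c2 c20 s2] := translation_scales (0, g.2).
have c1E : c1 = 1.
  have h := translation_dil_scales s1 (c' := c1 * c1).
  apply: (mulfI (lt0r_neq0 c10)); rewrite mulr1; apply/esym/h => x y.
  by rewrite dil2_horizontal -!heis_mulA !s1 mulrA.
have c2E : c2 = 1.
  have h := translation_dil_scales s2 (c' := c2 * c2 * (c2 * c2)).
  have E : c2 = c2 ^+ 4.
    rewrite {1}h; first by ring.
    by move=> x y; rewrite dil2_central -!heis_mulA !s2; ring.
  apply/eqP; rewrite -(@pexpr_eq1 _ c2 3)// ?ltW//.
  by apply/eqP/(mulfI (lt0r_neq0 c20)); rewrite mulr1 -exprS -E.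
move=> x y; rewrite (heis_split g) -!heis_mulA s1 s2 c1E c2E !mul1r //.
Qed.

Definition rho x := d o x.

Lemma dist_rho x y : d x y = rho (heis_mul (heis_inv y) x).
Proof.
rewrite /rho -(heis_mulVp y) (metricC d_metric x).
by rewrite translation_isometry mul1r.
Qed.

Lemma rho_inv x : rho (heis_inv x) = rho x.
Proof. by rewrite -(heis_mulpo (heis_inv x)) -dist_rho. Qed.

Lemma rho_o : rho o = 0.
Proof. exact: metric0. Qed.

Lemma rho_gt0 x : x != o -> 0 < rho x.
Proof. by move=> x0; rewrite metric_gt0// eq_sym. Qed.

Definition dil_ratio r := rho (dil r horizontal_point) / rho horizontal_point.

Lemma rho_dil r x : 0 < r -> rho (dil r x) = dil_ratio r * rho x.
Proof.
move=> r0; have [c c0 rc] := dil_scales r0.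
have rhoE y : rho (dil r y) = c * rho y by rewrite /rho -rc dil_o.
by rewrite /dil_ratio !rhoE mulfK// lt0r_neq0// rho_gt0// horizontal_point_neq0.
Qed.

Lemma dil_ratio_gt0 r : 0 < r -> 0 < dil_ratio r.
Proof.
move=> r0; rewrite divr_gt0// rho_gt0 ?horizontal_point_neq0//.
by rewrite -gauge_gt0 gauge_dil ?ltW// mulr_gt0// gauge_gt0 horizontal_point_neq0.
Qed.

Lemma dil_ratioM r s : 0 < r -> 0 < s -> dil_ratio (r * s) = dil_ratio r * dil_ratio s.
Proof.
by move=> r0 s0; rewrite {1}/dil_ratio -dil_comp rho_dil// mulrA.
Qed.

(** Otherwise rho would not decrease along the images of a point by powers of the
dilation, although these converge to o. *)
Lemma dil_ratio_lt1 r : 0 < r -> r < 1 -> dil_ratio r < 1.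
Proof.
move=> r0 r1; rewrite ltNge; apply/negP => mu1.
have p0 := rho_gt0 horizontal_point_neq0.
have [e e0 He] := small_gauge_small_dist p0.
have g0 : 0 < koranyi_gauge horizontal_point by rewrite gauge_gt0 horizontal_point_neq0.
have r01 : 0 <= r < 1 by rewrite (ltW r0) r1.
have [j rj] := small_power r01 (divr_gt0 e0 g0).
have rj0 : 0 < r ^+ j by rewrite exprn_gt0.
have muj : 1 <= dil_ratio (r ^+ j).
  elim: j {rj rj0} => [|j IH]; first by rewrite expr0 /dil_ratio dil_id divff// lt0r_neq0.
  by rewrite exprS dil_ratioM ?exprn_gt0// mulr_ege1.
have := He (dil (r ^+ j) horizontal_point); rewrite gauge_dil ?(ltW rj0)// -ltr_pdivlMr// => /(_ rj).
by rewrite -/(rho _) rho_dil// ltNge (ler_peMl (ltW p0)).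
Qed.

(** A small enough dilation maps the whole unit sphere into the d-unit ball. *)
Lemma rho_bounded : exists B, forall p, koranyi_gauge p = 1 -> rho p < B.
Proof.
have [e e0 He] := small_gauge_small_dist (@ltr01 R).
have e20 : 0 < e / 2 by rewrite divr_gt0.
exists (dil_ratio (e / 2))^-1 => p p1.
have := He (dil (e / 2) p); rewrite gauge_dil ?(ltW e20)// p1 mulr1.
rewrite ltr_pdivrMr// ltr_pMr// ltr1n => /(_ isT).
by rewrite -/(rho _) rho_dil// mulrC -ltr_pdivlMr ?dil_ratio_gt0// div1r.
Qed.

Lemma iter_isometry_gauge f j p : (forall x y, k (f x) (f y) = k x y) -> f o = o ->
  koranyi_gauge (iter j f p) = koranyi_gauge p.
Proof.
move=> fi fo; elim: j => //= j <-.
by rewrite -[LHS]koranyi_dist_o -{1}fo fi koranyi_dist_o.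
Qed.

(** If the d-ratio of f exceeded 1, the iterates of f would be unbounded for rho on the
unit sphere. *)
Lemma rho_isometry_le f p : isometry_o f -> koranyi_gauge p = 1 -> rho (f p) <= rho p.
Proof.
move=> [f' [fK fK' fi fo]] p1.
have [c c0 fc] : exists2 c, 0 < c & scales f c.
  by apply: (similarity_scales fK fK' ltr01) => x y; rewrite mul1r.
have rhoE y : rho (f y) = c * rho y by rewrite /rho -fc fo.
have p0 : 0 < rho p by rewrite rho_gt0// -gauge_gt0 p1.
rewrite rhoE ger_pMl// leNgt; apply/negP => c1.
have [B HB] := rho_bounded.
have B0 : 0 < B by apply: lt_trans p0 (HB _ p1).
have c01 : 0 <= c^-1 < 1 by rewrite invr_ge0 (ltW c0) invf_lt1.
have [j cj] := small_power c01 (divr_gt0 p0 B0).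
have jE : rho (iter j f p) = c ^+ j * rho p.
  by elim: j {cj} => [|j IH]; rewrite ?mul1r// iterS rhoE IH exprS mulrA.
have := HB (iter j f p); rewrite iter_isometry_gauge// jE => /(_ p1).
rewrite ltNge => /negP; apply.
move: cj; rewrite exprVn ltr_pdivlMr// mulrC ltr_pdivrMr ?exprn_gt0// mulrC.
exact: ltW.
Qed.

Lemma rho_isometry f p : isometry_o f -> koranyi_gauge p = 1 -> rho (f p) = rho p.
Proof.
move=> fP p1; apply/eqP; rewrite eq_le rho_isometry_le//=.
have [f' [fK fK' fi fo]] := fP.
have fP' : isometry_o f'.
  exists f; split => //; last by rewrite -{1}fo fK.
  by move=> x y; rewrite -fi !fK'.
rewrite -{1}(fK p); apply: rho_isometry_le => //.
by rewrite -[LHS]koranyi_dist_o -{1}fo fi koranyi_dist_o.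
Qed.

(** For |x| = 1 the constant rho x * rho (I x) equals rho x ^ 2, since a rotation
carries I x to the inverse of x. *)
Lemma rho_unit_sphere p q : koranyi_gauge p = 1 -> koranyi_gauge q = 1 -> rho p = rho q.
Proof.
have [c cE] : exists c, forall x, x != o -> rho x * rho (koranyi_inv x) = c.
  apply: (mobius_swap_inversion d_metric).
    exact: koranyi_inv_neq0.
  rewrite same_mobius; apply: swap_inversion_mobius.
  - exact: koranyi_distC.
  - by move=> x y z; exact: koranyi_quasi_triangle.
  - by move=> x; rewrite koranyi_dist_o gauge_gt0.
  - by rewrite koranyi_dist_o gauge0.
  - exact: koranyi_inv_neq0.
  - exact: koranyi_invK.
  - by move=> x; rewrite !koranyi_dist_o; exact: gauge_inv.
  - by move=> x y; rewrite !koranyi_dist_o; exact: koranyi_dist_inv.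
have sq x : koranyi_gauge x = 1 -> 0 < rho x /\ rho x ^+ 2 = c.
  move=> x1; have x0 : x != o by rewrite -gauge_gt0 x1.
  split; first exact: rho_gt0.
  have [f fP fx] := koranyi_inv_rotation n_oct x1.
  rewrite -(cE x x0) expr2 -{2}rho_inv -fx rho_isometry//.
  by rewrite gauge_inv// x1 invr1.
move=> /sq[p0 pE] /sq[q0 qE].
by apply/eqP; rewrite -(eqrXn2 (n := 2)) ?ltW// pE qE.
Qed.

(** The dilate of ratio 2 of p = (zeta, 0) is p p, and both o, p and p, p p are at
distance rho p. *)
Lemma dil_ratio2_le2 : dil_ratio 2 <= 2.
Proof.
have p0 := rho_gt0 horizontal_point_neq0.
rewrite -(ler_pM2r p0) -rho_dil// dil2_horizontal /rho.
case: (d_metric) => _ _ _ tri.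
apply: le_trans (tri _ horizontal_point _) _.
rewrite -{2}(heis_mulpo horizontal_point) translation_isometry mul1r mulrDl mul1r //.
Qed.

Lemma snowflake : exists alpha beta : R,
  [/\ 0 < alpha, alpha <= 1, 0 < beta &
      forall p q, d p q = beta * koranyi_dist p q `^ alpha].
Proof.
have [alpha a0 muE] := multiplicative_powR dil_ratio_gt0 dil_ratioM dil_ratio_lt1.
have g0 : 0 < koranyi_gauge horizontal_point by rewrite gauge_gt0 horizontal_point_neq0.
pose u := dil (koranyi_gauge horizontal_point)^-1 horizontal_point.
have u1 : koranyi_gauge u = 1.
  by rewrite gauge_dil ?invr_ge0 ?ltW// mulVf// lt0r_neq0.
exists alpha, (rho u); split => //.
- have := dil_ratio2_le2; rewrite muE// -ler_ln ?posrE ?powR_gt0// ln_powR.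
  by rewrite ger_pMl// ln_gt0// ltr1n.
- by rewrite rho_gt0// -gauge_gt0 u1.
move=> p q; rewrite dist_rho /koranyi_dist; set z := heis_mul _ _.
have [->|z0] := eqVneq z o.
  by rewrite rho_o gauge0 powR0 ?lt0r_neq0// mulr0.
have zg : 0 < koranyi_gauge z by rewrite gauge_gt0.
rewrite -{1}(dilVK (lt0r_neq0 zg) z) rho_dil// muE// mulrC; congr (_ * _).
apply: rho_unit_sphere => //.
by rewrite gauge_dil ?invr_ge0 ?ltW// mulVf// lt0r_neq0.
Qed.

End Rigidity.

Theorem mainTheorem1 (R : realType) (K : division_algebra) (n : nat)
    (n_ge2 : (2 <= n)%N) (n_oct : K = Octonions -> n = 2%N)
    (d : heis R K n -> heis R K n -> R)
    (d_metric : is_metric d)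
    (same_topology :
       ext_topology heis_o d = ext_topology heis_o koranyi_dist)
    (same_mobius : mobius heis_o d = mobius heis_o koranyi_dist) :
  exists alpha beta : R,
    [/\ 0 < alpha, alpha <= 1, 0 < beta &
        forall p q : option (heis R K n),
          ext_dist d p q =
          (beta%:E * poweR (ext_dist koranyi_dist p q) alpha)%E].
Proof.
have [alpha [beta [a0 a1 b0 dE]]] :=
  snowflake n_ge2 n_oct d_metric same_topology same_mobius.
exists alpha, beta; split => //.
by case=> [x|] [y|] /=; rewrite ?dE// ?gt_eqF// ?gt0_muley ?lte_fin// powR0 ?gt_eqF// mule0.
Qed.
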